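(* Let $T\colon \mathbb{R}^d\times \mathcal{X}\to \mathcal{X}$ be a continuous action of $\mathbb{R}^d$ on a nonempty compact metrizable space $\mathcal{X}$. Let $\mathbf{d}$ be a metric on $\mathcal{X}$ compatible with the topology and $\varphi\colon \mathcal{X}\to \mathbb{R}$ a continuous function. For any $\delta>0$ we have $$\overline{\mathrm{mdim}}_{\mathrm{M}}(\mathcal{X}, T, \mathbf{d}, \varphi) = \limsup_{\varepsilon\to 0} \frac{\sup_{x\in \mathcal{X}} P_T\left(B_\delta(x, \mathbf{d}_{\mathbb{R}^d}), \mathbf{d}, \varphi, \varepsilon\right)}{\log (1/\varepsilon)},$$ $$\underline{\mathrm{mdim}}_{\mathrm{M}}(\mathcal{X}, T, \mathbf{d}, \varphi) = \liminf_{\varepsilon\to 0} \frac{\sup_{x\in \mathcal{X}} P_T\left(B_\delta(x, \mathbf{d}_{\mathbb{R}^d}), \mathbf{d}, \varphi, \varepsilon\right)}{\log (1/\varepsilon)}.$$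
   Context: $d\ge 1$ is a natural number, $du$ is Lebesgue measure on $\mathbb{R}^d$, $\log=\log_2$. We write $T^u x=T(u,x)$, with $T^{u+v}=T^uT^v$, $T^0=\mathrm{id}$. Limits may take infinite values. For $L>0$ put $\mathbf{d}_L(x,y)=\sup_{u\in[0,L)^d}\mathbf{d}(T^ux,T^uy)$ and $\varphi_L(x)=\int_{[0,L)^d}\varphi(T^ux)\,du$. For $E\subset\mathcal{X}$ and $\varepsilon>0$, $$\#(E,\mathbf{d}_L,\varphi_L,\varepsilon)=\inf\Big\{\sum_{i=1}^n(1/\varepsilon)^{\sup_{U_i}\varphi_L}\ :\ E\subset U_1\cup\dots\cup U_n,\ \text{each }U_i\text{ open in }\mathcal{X}\text{ with }\mathrm{Diam}(U_i,\mathbf{d}_L)<\varepsilon\Big\},$$ $$P_T(E,\mathbf{d},\varphi,\varepsilon)=\liminf_{L\to\infty}\frac{\log\#(E,\mathbf{d}_L,\varphi_L,\varepsilon)}{L^d}.$$ For $E=\mathcal{X}$ this $\liminf$ is a limit. The upper and lower metric mean dimensions with potential are $$\overline{\mathrm{mdim}}_{\mathrm{M}}(\mathcal{X},T,\mathbf{d},\varphi)=\limsup_{\varepsilon\to0}\frac{P_T(\mathcal{X},\mathbf{d},\varphi,\varepsilon)}{\log(1/\varepsilon)},\qquad \underline{\mathrm{mdim}}_{\mathrm{M}}(\mathcal{X},T,\mathbf{d},\varphi)=\liminf_{\varepsilon\to0}\frac{P_T(\mathcal{X},\mathbf{d},\varphi,\varepsilon)}{\log(1/\varepsilon)}.$$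 For $x\in\mathcal{X}$ and $\delta>0$, $$B_\delta(x,\mathbf{d}_{\mathbb{R}^d})=\{y\in\mathcal{X}\ :\ \mathbf{d}(T^ux,T^uy)\le\delta\ \text{ for all }u\in\mathbb{R}^d\}.$$ *)

(* Defs.v *)
From HB Require Import structures.
From mathcomp Require Import all_boot all_order all_algebra.
From mathcomp Require Import all_classical all_reals all_analysis.

Set Implicit Arguments.
Unset Strict Implicit.
Unset Printing Implicit Defensive.

Import Order.TTheory GRing.Theory Num.Theory.
Import numFieldNormedType.Exports.

Local Open Scope classical_set_scope.
Local Open Scope ring_scope.

Definition cons_pair (R : realType) (n : nat)
    (p : measurableTypeR R * n.-tuple (measurableTypeR R)) :
  n.+1.-tuple (measurableTypeR R) := [tuple of p.1 :: p.2].

Lemma measurable_cons_pair (R : realType) (n : nat) :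
  measurable_fun [set: measurableTypeR R * n.-tuple (measurableTypeR R)]
    (@cons_pair R n).
Proof.
by apply: measurable_cons; [exact: measurable_fst|exact: measurable_snd].
Qed.

Definition lebesgue_cons (R : realType) (n : nat)
    (mu : {sigma_finite_measure set (n.-tuple (measurableTypeR R)) -> \bar R}) :
  set (n.+1.-tuple (measurableTypeR R)) -> \bar R :=
  pushforward (lebesgue_measure \x mu)%E (@cons_pair R n).

Lemma lebesgue_cons0 (R : realType) (n : nat)
    (mu : {sigma_finite_measure set (n.-tuple (measurableTypeR R)) -> \bar R}) :
  lebesgue_cons mu set0 = 0%E.
Proof. by rewrite /lebesgue_cons /pushforward preimage_set0 measure0. Qed.

Lemma lebesgue_cons_ge0 (R : realType) (n : nat)
    (mu : {sigma_finite_measure set (n.-tuple (measurableTypeR R)) -> \bar R})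
    (A : set (n.+1.-tuple (measurableTypeR R))) :
  (0 <= lebesgue_cons mu A)%E.
Proof. by rewrite /lebesgue_cons /pushforward measure_ge0. Qed.

Lemma lebesgue_cons_sigma_additive (R : realType) (n : nat)
    (mu : {sigma_finite_measure set (n.-tuple (measurableTypeR R)) -> \bar R}) :
  semi_sigma_additive (lebesgue_cons mu).
Proof.
have mf := @measurable_cons_pair R n.
move=> F mF tF mUF; rewrite /lebesgue_cons /pushforward preimage_bigcup.
apply: measure_semi_sigma_additive.
- by move=> k; rewrite -[X in measurable X]setTI; exact: mf.
- apply/trivIsetP => /= i j _ _ ij; rewrite -preimage_setI.
  by move/trivIsetP : tF => /(_ _ _ _ _ ij) ->//; rewrite preimage_set0.
- by rewrite -preimage_bigcup -[X in measurable X]setTI; exact: mf.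
Qed.

HB.instance Definition _ (R : realType) (n : nat)
    (mu : {sigma_finite_measure set (n.-tuple (measurableTypeR R)) -> \bar R}) :=
  isMeasure.Build _ _ _ (lebesgue_cons mu) (lebesgue_cons0 mu)
    (lebesgue_cons_ge0 mu) (@lebesgue_cons_sigma_additive R n mu).

Lemma lebesgue_cons_sigma_finite (R : realType) (n : nat)
    (mu : {sigma_finite_measure set (n.-tuple (measurableTypeR R)) -> \bar R}) :
  sigma_finite [set: n.+1.-tuple (measurableTypeR R)] (lebesgue_cons mu).
Proof.
have /sigma_finiteP[F [TF ndF Foo]] := sigma_finiteT (@lebesgue_measure R).
have /sigma_finiteP[G [TG ndG Goo]] := sigma_finiteT mu.
pose unc (t : n.+1.-tuple (measurableTypeR R)) :=
  (thead t, [tuple of behead t] : n.-tuple (measurableTypeR R)).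
have uncK : cancel (@cons_pair R n) unc.
  by move=> [x t]; congr pair; exact: val_inj.
have mun : measurable_fun setT unc.
  by apply/measurable_fun_pairP; split;
    [exact: measurable_tnth|exact: measurable_behead].
exists (fun k => unc @^-1` (F k `*` G k)).
  rewrite predeqE => t; split=> // _.
  have [i _ Fi] : (\bigcup_k F k) (thead t) by rewrite -TF.
  have [j _ Gj] : (\bigcup_k G k) [tuple of behead t] by rewrite -TG.
  exists (maxn i j) => //; split=> /=.
  - by move: Fi; exact/subsetPset/ndF/leq_maxl.
  - by move: Gj; exact/subsetPset/ndG/leq_maxr.
move=> k; have [mF Fk] := Foo k; have [mG Gk] := Goo k.
have mFG : measurable (F k `*` G k) by exact: measurableX.
split; first by rewrite -[X in measurable X]setTI; exact: mun.
rewrite /lebesgue_cons /pushforward -comp_preimage.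
rewrite (_ : unc \o _ = id) ?preimage_id; last by apply/funext => p; exact: uncK.
by rewrite product_measure1E// lte_mul_pinfty// ge0_fin_numE.
Qed.

HB.instance Definition _ (R : realType) (n : nat)
    (mu : {sigma_finite_measure set (n.-tuple (measurableTypeR R)) -> \bar R}) :=
  Measure_isSigmaFinite.Build _ _ _ (lebesgue_cons mu)
    (lebesgue_cons_sigma_finite mu).

Fixpoint lebesgue_tuple (R : realType) (n : nat) :
    {sigma_finite_measure set (n.-tuple (measurableTypeR R)) -> \bar R} :=
  match n with
  | 0 => dirac ([tuple] : 0.-tuple (measurableTypeR R))
  | m.+1 => lebesgue_cons (lebesgue_tuple R m)
  end.

(** Together with sigma-additivity, this determines [lebesgue_tuple]. *)
Lemma lebesgue_tuple_box (R : realType) (n : nat) (a b : 'I_n -> R) :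
  (forall i, a i <= b i) ->
  lebesgue_tuple R n
    [set t : n.-tuple (measurableTypeR R) |
      forall i, a i <= (tnth t i : R) < b i] =
  (\prod_(i < n) (b i - a i))%:E.
Proof.
elim: n a b => [|n IHn] a b ab.
  rewrite big_ord0 /= diracE mem_set//=.
  by case.
have mbox : measurable [set t : n.-tuple (measurableTypeR R) |
    forall i : 'I_n, a (lift ord0 i) <= (tnth t i : R) < b (lift ord0 i)].
  rewrite (_ : mkset _ = \bigcap_(i in [set: 'I_n])
    ((fun t : n.-tuple (measurableTypeR R) => tnth t i) @^-1`
      (`[a (lift ord0 i), b (lift ord0 i)[ : set (measurableTypeR R)))).
    apply: fin_bigcap_measurable; first
      by apply: (sub_finite_set _ (finite_finpred predT)).
    move=> i _; rewrite -[X in measurable X]setTI; apply: measurable_tnth => //.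
  apply/seteqP; split=> t /= H i; first by move=> _; rewrite /= in_itv /= H.
  by have := H i I; rewrite /= in_itv.
rewrite /= /lebesgue_cons /pushforward.
rewrite (_ : _ @^-1` _ = (`[a ord0, b ord0[ : set (measurableTypeR R)) `*`
    [set t : n.-tuple (measurableTypeR R) |
      forall i, a (lift ord0 i) <= (tnth t i : R) < b (lift ord0 i)]); last first.
  apply/seteqP; split=> -[x t] /=.
    move=> H; split; first by rewrite in_itv/=; exact: H ord0.
    by move=> i; have := H (lift ord0 i); rewrite tnthS.
  rewrite in_itv /= => -[H0 H] i; case: (unliftP ord0 i) => [j|] -> //.
  by rewrite /cons_pair /= tnthS.
rewrite product_measure1E//=.
rewrite IHn; last by move=> i; exact: ab.
rewrite lebesgue_measure_itv/= lte_fin big_ord_recl EFinM.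
case: ltgtP (ab ord0) => // ->; by rewrite subrr !mul0e.
Qed.

(** A metric compatible with the topology of [X] is rendered by taking [X] to be
    a [metricType]: its topology is the one induced by the metric [mdist]. *)

Definition continuous_action (R : realType) (d : nat) (X : metricType R)
    (T : 'rV[R]_d -> X -> X) : Prop :=
  [/\ forall x, T 0 x = x,
      forall u v x, T (u + v) x = T u (T v x) &
      continuous (fun p : 'rV[R]_d * X => T p.1 p.2)].

Definition cube (R : realType) (d : nat) (L : R) : set 'rV[R]_d :=
  [set u | forall i, 0 <= u ord0 i < L].

(** The real-valued [sup]s below are taken over sets that are bounded as soon as
    [X] is compact and the data are continuous; [sup set0 = 0]. *)

Definition dist_cube (R : realType) (d : nat) (X : metricType R)
    (T : 'rV[R]_d -> X -> X) (L : R) (x y : X) : R :=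
  sup [set mdist (T u x) (T u y) | u in cube L].

Definition diam (R : realType) (X : Type) (dist : X -> X -> R) (U : set X) : R :=
  sup [set dist x y | x in U & y in U].

(** Points of R^d are row vectors, whereas the product sigma-algebra and
    [lebesgue_tuple] live on tuples. *)
Definition row_of_tuple (R : realType) (d : nat)
    (t : d.-tuple (measurableTypeR R)) : 'rV[R]_d :=
  \row_i (tnth t i : R).

Definition potential_cube (R : realType) (d : nat) (X : metricType R)
    (T : 'rV[R]_d -> X -> X) (phi : X -> R) (L : R) (x : X) : R :=
  \int[lebesgue_tuple R d]_(t in @row_of_tuple R d @^-1` cube L)
    phi (T (row_of_tuple t) x).

(** An empty [U i] contributes [(1 / eps) `^ 0 = 1] instead of 0; this does not
    affect the infimum, since empty members can be dropped from a cover. *)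
Definition cover_cost (R : realType) (d : nat) (X : metricType R)
    (T : 'rV[R]_d -> X -> X) (phi : X -> R) (E : set X) (L eps : R) : \bar R :=
  ereal_inf [set c | exists n (U : 'I_n -> set X),
    [/\ forall i, open (U i),
        forall i, diam (dist_cube T L) (U i) < eps,
        E `<=` \bigcup_i U i &
        c = (\sum_(i < n)
          (1 / eps) `^ sup (potential_cube T phi L @` U i))%:E]].

Definition log2 (R : realType) (x : R) : R := ln x / ln 2.

Definition log2e (R : realType) (x : \bar R) : \bar R :=
  (lne x * ((ln 2)^-1)%:E)%E.

Definition pressure (R : realType) (d : nat) (X : metricType R)
    (T : 'rV[R]_d -> X -> X) (phi : X -> R) (E : set X) (eps : R) : \bar R :=
  limf_einf (fun L : R => (log2e (cover_cost T phi E L eps) * ((L ^+ d)^-1)%:E)%E)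
    (pinfty_nbhs R).

Definition upper_mdim (R : realType) (d : nat) (X : metricType R)
    (T : 'rV[R]_d -> X -> X) (phi : X -> R) : \bar R :=
  limf_esup (fun eps : R =>
    (pressure T phi [set: X] eps * ((log2 (1 / eps))^-1)%:E)%E) 0^'+.

Definition lower_mdim (R : realType) (d : nat) (X : metricType R)
    (T : 'rV[R]_d -> X -> X) (phi : X -> R) : \bar R :=
  limf_einf (fun eps : R =>
    (pressure T phi [set: X] eps * ((log2 (1 / eps))^-1)%:E)%E) 0^'+.

Definition orbit_ball (R : realType) (d : nat) (X : metricType R)
    (T : 'rV[R]_d -> X -> X) (delta : R) (x : X) : set X :=
  [set y | forall u : 'rV[R]_d, mdist (T u x) (T u y) <= delta].

(* Main.v *)
(** Divide [0, V)^d into cubes of side M and bound covers by multiplicativity: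
    covers of disjoint regions multiply, and the integral of the potential over
    a union is the sum of the integrals.  Let b be the infimum of the rates s
    such that, for some M, every Bowen ball B_delta(x, d_M) has a cover of cost
    at most e^(s M^d).  Covering X by Bowen balls of radius delta takes at most
    c^(V^d) of them, with c independent of eps, so the pressure of X at scale
    eps is at most b + log c; after division by log (1/eps) the term log c
    disappears.

    It remains to bound b by the supremum of the pressures of the sets
    B_delta(x, d_{R^d}).  If the pressure is below q at every x, then every x
    has a tile size l for which its orbit ball has a cover of cost e^(q l^d).
    The cover consists of open sets, so it also covers
    B_delta(y, d_{[-N, N]^d}) for y close to x and N large, and compactness
    gives finitely many tile sizes.  A Vitali selection then provides disjoint
    good tiles occupying at least 4^-d of a large cube; paying the rate q on
    them and a rate close to b on the remaining cells would produce a rate below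
    b if q < b. *)
Require Import Defs.
From HB Require Import structures.
From mathcomp Require Import all_boot all_order all_algebra.
From mathcomp Require Import all_classical all_reals all_analysis.
From mathcomp Require Import measurable_realfun ring lra zify.

Set Implicit Arguments.
Unset Strict Implicit.
Unset Printing Implicit Defensive.

Import Order.TTheory GRing.Theory Num.Theory.
Import numFieldNormedType.Exports.

Local Open Scope classical_set_scope.
Local Open Scope ring_scope.

(** * Lebesgue measure on tuples is invariant under translations *)

Definition tuple_shift (R : realType) (n : nat) (v : 'I_n -> R)
    (t : n.-tuple (measurableTypeR R)) : n.-tuple (measurableTypeR R) :=
  [tuple tnth t i + v i | i < n].

Lemma measurable_tuple_shift (R : realType) (n : nat) (v : 'I_n -> R) :
  measurable_fun [set: n.-tuple (measurableTypeR R)] (tuple_shift v).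
Proof.
apply/measurable_fun_tnthP => i.
rewrite (_ : _ \o _ = (fun t : n.-tuple (measurableTypeR R) =>
    (tnth t i : R) + v i)).
  apply: measurable_funD => //; exact: measurable_tnth.
by apply/funext => t /=; rewrite tnth_mktuple.
Qed.

Lemma measurable_shift (R : realType) (a : R) :
  measurable_fun [set: measurableTypeR R] (fun x : measurableTypeR R => x + a).
Proof. by apply: measurable_funD. Qed.

(* The measure structure on [pushforward m f] is indexed by a proof that [f] is
   measurable, which canonical inference cannot supply. *)
Lemma pushforward_is_measure d1 d2 (T1 : measurableType d1)
    (T2 : measurableType d2) (R : realType)
    (m : {measure set T1 -> \bar R}) (f : T1 -> T2) :
  measurable_fun setT f ->
  exists m' : {measure set T2 -> \bar R}, forall A, m' A = m (f @^-1` A).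
Proof.
move=> mf.
by exists (measure_function_pushforward__canonical__measure_function_Measure m mf).
Qed.

(** The pushforward under the translation gives every interval its length, which characterises
    [lebesgue_measure]. *)
Lemma lebesgue_measure_shift (R : realType) (a : R)
    (A : set (measurableTypeR R)) : measurable A ->
  lebesgue_measure ((fun x : R => x + a) @^-1` A) = lebesgue_measure A.
Proof.
move=> mA.
have [m' m'E] := @pushforward_is_measure _ _ (measurableTypeR R)
  (measurableTypeR R) R lebesgue_measure _ (measurable_shift a).
rewrite -[LHS]m'E; apply: esym.
apply: (lebesgue_measure_unique (mu := m')) => // _ [[x y] _ <-] /=.
rewrite m'E; transitivity (lebesgue_measure
    ([set` `](x - a), (y - a)]] : set (measurableTypeR R))).
  rewrite !lebesgue_measure_itv/= !lte_fin ltrD2r; case: ifP => // _.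
  by rewrite -!EFinB; congr EFin; lra.
by congr lebesgue_measure; apply/seteqP; split=> z /=; rewrite !in_itv/=; lra.
Qed.

(** Induction on [n]: through [cons_pair] the shift acts separately on the head and on the tail, so
    its pushforward agrees with the product measure on rectangles, and uniqueness of the product
    measure concludes. *)
Lemma lebesgue_tuple_shift (R : realType) (n : nat) (v : 'I_n -> R)
    (A : set (n.-tuple (measurableTypeR R))) : measurable A ->
  lebesgue_tuple R n (tuple_shift v @^-1` A) = lebesgue_tuple R n A.
Proof.
elim: n v A => [|n IHn] v A mA.
  rewrite (_ : _ @^-1` _ = A)//; apply/seteqP.
  by split=> t /=; rewrite [tuple_shift v t]tuple0 [t]tuple0.
rewrite /= /lebesgue_cons /pushforward.
pose w i := v (lift ord0 i).
pose f (p : measurableTypeR R * n.-tuple (measurableTypeR R)) :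
  measurableTypeR R * n.-tuple (measurableTypeR R) :=
  ((p.1 : R) + v ord0, tuple_shift w p.2).
have mf : measurable_fun setT f.
  apply/measurable_fun_pairP; split.
    exact: (measurableT_comp (measurable_shift (v ord0)) measurable_fst).
  exact: (measurableT_comp (measurable_tuple_shift w) measurable_snd).
have fE p : tuple_shift v (cons_pair p) = cons_pair (f p).
  case: p => x t; apply: eq_from_tnth => i; rewrite tnth_mktuple /f /cons_pair /=.
  by case: (unliftP ord0 i) => [j|] ->; rewrite ?tnthS ?tnth_mktuple.
have mB : measurable (@cons_pair R n @^-1` A).
  by rewrite -[X in measurable X]setTI; exact: measurable_cons_pair.
have [m' m'E] := pushforward_is_measure
  (lebesgue_measure \x (lebesgue_tuple R n))%E mf.
rewrite (_ : _ @^-1` _ = f @^-1` (@cons_pair R n @^-1` A)); last first.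
  by apply/funext => p; rewrite /preimage/= fE.
transitivity (m' (@cons_pair R n @^-1` A)); first by rewrite m'E.
apply: esym; apply: (product_measure_unique (m' := m')) => // B C mB' mC.
rewrite m'E; transitivity ((lebesgue_measure \x lebesgue_tuple R n)%E
  (((fun x : measurableTypeR R => (x : R) + v ord0 : measurableTypeR R)
      @^-1` B) `*` (tuple_shift w @^-1` C))) => //.
rewrite product_measure1E//; first
  by congr (_ * _)%E; [exact: lebesgue_measure_shift|exact: IHn].
  by rewrite -[X in measurable X]setTI; exact: measurable_shift.
by rewrite -[X in measurable X]setTI; exact: measurable_tuple_shift.
Qed.

(** * Borel measurability on row vectors *)

(** Second countability: [O] is the union of the sup-norm balls with rational centre and radius
    [1 / (k + 1)] that it contains, and each such ball is a finite intersection of conditions on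
    single coordinates. *)
Lemma measurable_row_open (R : realType) (d : nat) (O : set 'rV[R]_d) :
  open O -> measurable (@row_of_tuple R d @^-1` O).
Proof.
move=> oO.
have [r r0] : exists r : nat -> R, r = fun k => k.+1%:R^-1 by eexists.
pose B (p : 'rV[rat]_d * nat) : set 'rV[R]_d :=
  ball (map_mx ratr p.1 : 'rV[R]_d) (r p.2).
have r_gt0 k : 0 < r k by rewrite r0 invr_gt0 ltr0n.
(* Balls that leave [O] are replaced by the empty set, so that the union runs over a whole countable
   type. *)
pose F p := if `[< B p `<=` O >] then @row_of_tuple R d @^-1` B p else set0.
have -> : @row_of_tuple R d @^-1` O = \bigcup_p F p.
  apply/seteqP; split=> [t Ot|t [p _]]; last first.
    by rewrite /F; case: asboolP => // BO /BO.
  set x := row_of_tuple t in Ot.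
  have [e /= e0 xeO] : exists2 e : R, 0 < e & ball x e `<=` O.
    have : nbhs x O by exact: open_nbhs_nbhs.
    by move=> /nbhs_ballP[e e0 xe]; exists e.
  (* A ball of radius [r k] whose centre is within [r k] of [x] contains [x] and stays within
     [2 * r k < e] of it. *)
  have [k ke] : exists k, r k < e / 2.
    have e20 : 0 < e / 2 by lra.
    exists (Num.truncn (e / 2)^-1).
    rewrite r0 -ltf_pV2 ?posrE ?invr_gt0 ?ltr0n// invrK.
    exact: truncnS_gt.
  have k0 := r_gt0 k.
  have [c cx] : {c : 'I_d -> rat &
      forall i, `|ratr (c i) - x ord0 i| < r k}.
    apply: (@choice _ _ (fun i q => `|ratr q - x ord0 i| < r k)) => i.
    have xk : x ord0 i - r k < x ord0 i + r k by lra.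
    have [q] := rat_in_itvoo xk.
    by rewrite in_itv/= => qx; exists q; rewrite ltr_norml; lra.
  exists (\row_i c i, k) => //; rewrite /F asboolT//.
    split=> [|i j] /=; first exact: r_gt0.
    rewrite ord1 !mxE /ball/=.
    by have := cx j; rewrite /x mxE.
  move=> y [_ By]; apply: xeO; split=> // i j; rewrite ord1.
  have := By ord0 j; have := cx j; rewrite /ball/= /x !mxE /= !ltr_norml; lra.
apply: countable_bigcupT_measurable; first exact: countableP.
move=> p; rewrite /F; case: asboolP => // _.
have -> : @row_of_tuple R d @^-1` B p = \bigcap_(i in [set: 'I_d])
    ((fun t : d.-tuple (measurableTypeR R) => tnth t i) @^-1`
     (ball (ratr (p.1 ord0 i) : R) (r p.2) : set (measurableTypeR R))).
  apply/seteqP; split=> [t [_ Bt] i _|t Bt].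
    by have := Bt ord0 i; rewrite !mxE.
  split; first exact: r_gt0.
  by move=> i j; rewrite ord1 !mxE; exact: (Bt j).
apply: fin_bigcap_measurable.
  by apply: (sub_finite_set _ (finite_finpred predT)).
move=> i _; rewrite -[X in measurable X]setTI; apply: measurable_tnth => //.
exact: measurable_ball.
Qed.

Lemma measurable_row_fun (R : realType) (d : nat) (g : 'rV[R]_d -> R) :
  continuous g ->
  measurable_fun [set: d.-tuple (measurableTypeR R)] (g \o @row_of_tuple R d).
Proof.
move=> cg; apply: (measurability _ (RGenOpens.measurableE R)).
move=> /= _ [_ [a [b ->]] <-]; rewrite setTI comp_preimage.
apply: measurable_row_open; apply: open_comp; last exact: itv_open.
by move=> x _; exact: cg.
Qed.

(** * Integrals along the orbit *)

Section orbit_integral.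
Variables (R : realType) (d : nat) (X : metricType R).
Variables (T : 'rV[R]_d -> X -> X) (phi : X -> R) (H : R).
Hypothesis T_action : continuous_action T.
Hypothesis phi_continuous : continuous phi.
Hypothesis phi_le : forall x, `|phi x| <= H.

Definition finite_volume (D : set 'rV[R]_d) : Prop :=
  measurable (@row_of_tuple R d @^-1` D) /\
  (lebesgue_tuple R d (@row_of_tuple R d @^-1` D) < +oo)%E.

Definition volume (D : set 'rV[R]_d) : R :=
  fine (lebesgue_tuple R d (@row_of_tuple R d @^-1` D)).

(** For [D := cube L] this is [potential_cube]; other [D] arise when a cube is cut into pieces. *)
Definition orbit_integral (D : set 'rV[R]_d) (x : X) : R :=
  \int[lebesgue_tuple R d]_(t in @row_of_tuple R d @^-1` D)
    phi (T (row_of_tuple t) x).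

Lemma continuous_orbit (x : X) : continuous (fun u => T u x).
Proof.
case: T_action => _ _ cT u.
apply: (@continuous_comp _ _ _ (fun u => (u, x)) (fun p => T p.1 p.2) u).
  exact: (@cvg_pair _ _ _ (nbhs u) (nbhs u) (nbhs x) _ _ _ id (fun=> x)
    cvg_id (cvg_cst x)).
exact: cT.
Qed.

Lemma continuous_act (u : 'rV[R]_d) : continuous (T u).
Proof.
case: T_action => _ _ cT x.
apply: (@continuous_comp _ _ _ (fun x => (u, x)) (fun p => T p.1 p.2) x).
  exact: (@cvg_pair _ _ _ (nbhs x) (nbhs u) (nbhs x) _ _ _ (fun=> u) id
    (cvg_cst u) cvg_id).
exact: cT.
Qed.

Lemma measurable_orbit (x : X) : measurable_fun setT
  (fun t : d.-tuple (measurableTypeR R) => phi (T (row_of_tuple t) x)).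
Proof.
apply: (@measurable_row_fun R d (fun u => phi (T u x))) => u.
apply: (@continuous_comp _ _ _ (fun u => T u x) phi).
  exact: continuous_orbit.
exact: phi_continuous.
Qed.

Lemma integrable_orbit (D : set 'rV[R]_d) (x : X) : finite_volume D ->
  (lebesgue_tuple R d).-integrable (@row_of_tuple R d @^-1` D)
    (EFin \o (fun t => phi (T (row_of_tuple t) x))).
Proof.
move=> [mD Doo]; apply: measurable_bounded_integrable => //.
  exact: measurable_funTS (measurable_orbit x).
exists H; split; first by rewrite num_real.
by move=> M HM t Dt /=; rewrite (le_trans (phi_le _))// ltW.
Qed.

Lemma finite_volumeU (D E : set 'rV[R]_d) :
  finite_volume D -> finite_volume E -> finite_volume (D `|` E).
Proof.
move=> [mD Doo] [mE Eoo]; split; rewrite preimage_setU.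
  exact: measurableU.
by rewrite (le_lt_trans (measureU2 _ _ _))// lte_add_pinfty.
Qed.

Lemma finite_volume_sub (D E : set 'rV[R]_d) :
  measurable (@row_of_tuple R d @^-1` D) -> D `<=` E ->
  finite_volume E -> finite_volume D.
Proof.
move=> mD DE [mE Eoo]; split=> //; apply: le_lt_trans Eoo.
by apply: le_measure; rewrite ?inE//; exact: preimage_subset.
Qed.

Lemma orbit_integralU (D E : set 'rV[R]_d) (x : X) :
  finite_volume D -> finite_volume E -> [disjoint D & E] ->
  orbit_integral (D `|` E) x = orbit_integral D x + orbit_integral E x.
Proof.
move=> vD vE DE; rewrite /orbit_integral preimage_setU Rintegral_setU//.
- by case: vD.
- by case: vE.
- by rewrite -preimage_setU; apply: integrable_orbit; exact: finite_volumeU.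
- move: DE; rewrite !disj_set2E => /eqP DE; apply/eqP.
  by rewrite -(preimage_setI (@row_of_tuple R d)) DE preimage_set0.
Qed.

Lemma orbit_integral_norm_le (D : set 'rV[R]_d) (x : X) :
  finite_volume D -> `|orbit_integral D x| <= H * volume D.
Proof.
move=> vD; have [mD Doo] := vD; rewrite -Rintegral_cst//.
apply: (le_trans (le_normr_Rintegral _ _)) => //; first exact: integrable_orbit.
apply: le_Rintegral => //.
- by apply: integrable_norm; exact: integrable_orbit.
- apply: measurable_bounded_integrable => //.
  exists H; split=> [|M HM t Dt /=]; first exact: num_real.
  rewrite ger0_norm; first exact: ltW.
  exact: le_trans (normr_ge0 _) (phi_le x).
Qed.

(** Change of variables along the measure-preserving [tau], with [T (u - v) (T v x) = T u x]. *)
Lemma orbit_integral_shift (D : set 'rV[R]_d) (v : 'rV[R]_d) (x : X) :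
  finite_volume D ->
  orbit_integral [set u | D (u - v)] x = orbit_integral D (T v x).
Proof.
move=> vD; have [mD Doo] := vD.
have [T0 TD _] := T_action.
pose tau := tuple_shift (fun i : 'I_d => - v ord0 i).
have ms : measurable_fun setT tau by exact: measurable_tuple_shift.
have rowE t : row_of_tuple (tau t) = row_of_tuple t - v.
  by apply/rowP => i; rewrite !mxE tnth_mktuple.
pose f t := (phi (T (row_of_tuple t) (T v x)))%:E.
have fE t : f (tau t) = (phi (T (row_of_tuple t) x))%:E.
  by rewrite /f rowE -TD subrK.
have mf : measurable_fun setT f 
  by apply/measurable_EFinP; exact: (measurable_orbit (T v x)).
have preE : @row_of_tuple R d @^-1` [set u | D (u - v)] =
    tau @^-1` (@row_of_tuple R d @^-1` D).
  by rewrite -comp_preimage; apply/seteqP; split=> t /=; rewrite rowE.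
have vD' : finite_volume [set u | D (u - v)].
  split; rewrite preE; first by rewrite -[X in measurable X]setTI; exact: ms.
  by rewrite lebesgue_tuple_shift.
rewrite /orbit_integral /Rintegral; congr fine.
have := integral_pushforward (f := f) ms (mu := lebesgue_tuple R d) mf _ mD.
rewrite -preE => pushE.
transitivity (\int[pushforward (lebesgue_tuple R d) tau]_(t in
    @row_of_tuple R d @^-1` D) f t)%E.
  rewrite pushE; first by apply: eq_integral => t _; rewrite /= fE.
  apply: eq_integrable (integrable_orbit x vD').
    by case: vD'.
  by move=> t _; rewrite /= fE.
by apply: eq_measure_integral => A mA _; exact: lebesgue_tuple_shift.
Qed.

End orbit_integral.

(** * Boxes, cells and tiles *)

Definition box (R : realType) (d : nat) (a b : 'I_d -> R) : set 'rV[R]_d :=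
  [set u | forall i, a i <= u ord0 i < b i].

Lemma measurable_box (R : realType) (d : nat) (a b : 'I_d -> R) :
  measurable (@row_of_tuple R d @^-1` box a b).
Proof.
have -> : @row_of_tuple R d @^-1` box a b = \bigcap_(i in [set: 'I_d])
    ((fun t : d.-tuple (measurableTypeR R) => tnth t i) @^-1`
      (`[a i, b i[ : set (measurableTypeR R))).
  apply/seteqP; split=> [t tab i _|t tab i].
    by have := tab i; rewrite mxE /= in_itv.
  by have := tab i I; rewrite mxE /= in_itv.
apply: fin_bigcap_measurable.
  by apply: (sub_finite_set _ (finite_finpred predT)).
by move=> i _; rewrite -[X in measurable X]setTI; exact: measurable_tnth.
Qed.

Lemma lebesgue_box (R : realType) (d : nat) (a b : 'I_d -> R) :
  (forall i, a i <= b i) ->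
  lebesgue_tuple R d (@row_of_tuple R d @^-1` box a b) =
    (\prod_(i < d) (b i - a i))%:E.
Proof.
move=> ab; rewrite -lebesgue_tuple_box//; congr (lebesgue_tuple R d _).
by apply/seteqP; split=> t /= tab i; have := tab i; rewrite mxE.
Qed.

Lemma finite_volume_box (R : realType) (d : nat) (a b : 'I_d -> R) :
  (forall i, a i <= b i) -> finite_volume (box a b).
Proof.
by move=> ab; split; [exact: measurable_box|rewrite lebesgue_box// ltry].
Qed.

Lemma finite_volume_cube (R : realType) (d : nat) (L : R) :
  0 <= L -> finite_volume (@cube R d L).
Proof. by move=> L0; exact: (@finite_volume_box R d (fun=> 0) (fun=> L)). Qed.

Lemma volume_cube (R : realType) (d : nat) (L : R) :
  0 <= L -> volume (@cube R d L) = L ^+ d.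
Proof.
move=> L0; rewrite /volume (@lebesgue_box R d (fun=> 0) (fun=> L))//=.
by rewrite subr0 prodr_const card_ord.
Qed.

Section tiles.
Variables (d n : nat).
Notation cell := {ffun 'I_d -> 'I_n}.

(** A tile that sticks out of the grid is clipped, and then has fewer than [l ^ d] cells. *)
Definition tile (t : 'I_d -> nat) (l : nat) : {set cell} :=
  [set k : cell | [forall i, (t i <= k i < t i + l)%N]].

Lemma tile_cell (t : cell) : tile (fun i => t i) 1 = [set t]%SET.
Proof.
apply/setP => k; rewrite !inE; apply/forallP/eqP => [tk|-> i].
  by apply/ffunP => i; apply/val_inj => /=; have := tk i; lia.
by rewrite leqnn addn1 ltnS leqnn.
Qed.

End tiles.

Section cells.
Variables (R : realType) (d n : nat) (M : R).
Hypothesis M_gt0 : 0 < M.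
Notation cell := {ffun 'I_d -> 'I_n}.

(* The cell [k] stands for the cube [M k + [0, M)^d]. *)
Definition region (A : {set cell}) : set 'rV[R]_d :=
  [set u | exists2 k : cell, k \in A &
     forall i, M * (k i)%:R <= u ord0 i < M * (k i).+1%:R].

Definition corner (t : 'I_d -> nat) : 'rV[R]_d := \row_i (M * (t i)%:R).

Lemma regionU (A B : {set cell}) :
  region (A :|: B) = region A `|` region B.
Proof.
apply/seteqP; split=> [u [k]|u [] [k kA uk]].
- by rewrite inE => /orP[kA|kB] uk; [left|right]; exists k.
- by exists k => //; rewrite inE kA.
- by exists k => //; rewrite inE kA orbT.
Qed.

(** Cells are half-open, so a point determines its cell: [M j <= u_i < M (j' + 1)] forces [j <= j'],
    and the roles can be exchanged. *)
Lemma region_disjoint (A B : {set cell}) :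
  [disjoint A & B]%B -> [disjoint region A & region B].
Proof.
move=> AB; rewrite disj_set2E; apply/eqP/seteqP; split=> // u.
move=> [[k kA uk] [k' kB uk']].
suff kk' : k = k' by rewrite -kk' in kB; rewrite (disjointFr AB kA) in kB.
apply/ffunP => i; apply/val_inj => /=.
have /andP[k1 k2] := uk i; have /andP[k'1 k'2] := uk' i.
have kk j j' : M * j%:R <= u ord0 i -> u ord0 i < M * j'.+1%:R -> (j <= j')%N.
  move=> j1 j'2; rewrite -ltnS -(ltr_nat R) -(ltr_pM2l M_gt0).
  exact: le_lt_trans j1 j'2.
by apply/eqP; rewrite eqn_leq !kk.
Qed.

(** The cell of a point [u] has the integer parts of [u_i / M] as coordinates; the hypothesis keeps
    it inside the grid. *)
Lemma region_tile (t : 'I_d -> nat) (l : nat) : (forall i, (t i + l <= n)%N) ->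
  region (tile n t l) = [set u | cube (M * l%:R) (u - corner t)].
Proof.
move=> tl; apply/seteqP; split=> [u [k]|u uc].
  rewrite inE => /forallP kt uk i; have /andP[k1 k2] := kt i.
  have /andP[u1 u2] := uk i; rewrite !mxE; apply/andP; split.
    by rewrite subr_ge0 (le_trans _ u1)// ler_pM2l// ler_nat.
  by rewrite ltrBlDl (lt_le_trans u2)// -mulrDr ler_pM2l// -natrD ler_nat.
have ui i : M * (t i)%:R <= u ord0 i < M * (t i + l)%:R.
  by have := uc i; rewrite !mxE subr_ge0 ltrBlDl natrD mulrDr.
have u0 i : 0 <= u ord0 i / M.
  have /andP[u1 _] := ui i; rewrite divr_ge0 ?(ltW M_gt0)//.
  by rewrite (le_trans _ u1)// mulr_ge0// ltW.
have kP i : (t i <= Num.truncn (u ord0 i / M) < t i + l)%N.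
  have /andP[u1 u2] := ui i; rewrite truncn_ge_nat ?u0// ler_pdivlMr// mulrC u1/=.
  by rewrite truncn_lt_nat ?u0// ltr_pdivrMr// mulrC.
have kn i : (Num.truncn (u ord0 i / M) < n)%N.
  by have /andP[_ /leq_trans] := kP i; apply.
exists [ffun i => Ordinal (kn i)].
  by rewrite inE; apply/forallP => i; rewrite ffunE.
move=> i; rewrite ffunE /=; have /andP[u1 u2] := truncn_itv (u0 i).
by rewrite mulrC -ler_pdivlMr// u1/= mulrC -ltr_pdivrMr.
Qed.

Lemma region_setT : region [set: cell] = cube (M * n%:R).
Proof.
apply/seteqP; split=> [u [k _ uk] i|u uc].
  have /andP[u1 u2] := uk i; apply/andP; split.
    by rewrite (le_trans _ u1)// mulr_ge0// ltW.
  by rewrite (lt_le_trans u2)// ler_pM2l// ler_nat.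
have u0 i : 0 <= u ord0 i / M.
  by have /andP[u1 _] := uc i; rewrite divr_ge0 ?(ltW M_gt0).
have kn i : (Num.truncn (u ord0 i / M) < n)%N.
  have /andP[_ u2] := uc i.
  by rewrite truncn_lt_nat ?u0// ltr_pdivrMr// mulrC.
exists [ffun i => Ordinal (kn i)]; first by rewrite inE.
move=> i; rewrite ffunE /=; have /andP[u1 u2] := truncn_itv (u0 i).
by rewrite mulrC -ler_pdivlMr// u1/= mulrC -ltr_pdivrMr.
Qed.

Lemma finite_volume_region (A : {set cell}) : finite_volume (region A).
Proof.
apply: (@finite_volume_sub _ _ _ (cube (M * n%:R))).
- have -> : @row_of_tuple R d @^-1` region A = \bigcup_(k in [set` A])
      (@row_of_tuple R d @^-1` box (fun i => M * (k i)%:R)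
         (fun i => M * (k i).+1%:R)).
    by apply/seteqP; split=> t [k kA tk]; exists k.
  apply: fin_bigcup_measurable => [|k _]; last exact: measurable_box.
  exact: finite_finset.
- by rewrite -region_setT => u [k _ uk]; exists k; rewrite ?inE.
- by apply: finite_volume_cube; rewrite mulr_ge0// ltW.
Qed.

End cells.

(** * A discrete Vitali lemma *)

Lemma card_ord_interval (n a l : nat) :
  #|[pred j : 'I_n | (a <= j < a + l)%N]| = (minn (a + l) n - a)%N.
Proof.
rewrite -sum1_card big_mkcond/=.
elim: n => [|n IHn]; first by rewrite big_ord0; lia.
by rewrite big_ord_recr/= IHn unfold_in /=; case: ifP; lia.
Qed.

Section tile_cover.
Variables (d n : nat).
Notation cell := {ffun 'I_d -> 'I_n}.

Lemma card_tileE (t : 'I_d -> nat) (l : nat) :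
  #|tile n t l| = (\prod_(i < d) (minn (t i + l) n - t i))%N.
Proof.
pose F i : pred 'I_n := fun j => (t i <= j < t i + l)%N.
transitivity #|(family F : simpl_pred cell)|.
  by apply: eq_card => k; rewrite inE; apply/forallP/familyP => kt i; exact: kt.
rewrite card_family foldrE big_map big_enum/=; apply: eq_bigr => i _.
by rewrite -card_ord_interval.
Qed.

Lemma card_tile (t : 'I_d -> nat) (l : nat) :
  (forall i, (t i + l <= n)%N) -> #|tile n t l| = (l ^ d)%N.
Proof.
move=> tl; rewrite card_tileE (eq_bigr (fun=> l)).
  by rewrite prod_nat_const card_ord.
by move=> i _; have := tl i; lia.
Qed.

Lemma card_tile_le (t : 'I_d -> nat) (l : nat) : (#|tile n t l| <= l ^ d)%N.
Proof.
rewrite card_tileE -[X in (_ <= _ ^ X)%N]card_ord -prod_nat_const.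
by apply: leq_prod => i _; lia.
Qed.

(** Greedy choice: take an index of maximal size, discard all indices whose sets meet its set, and
    repeat. A discarded index meets a chosen one that is at least as large. *)
Lemma greedy_disjoint (I C : finType) (F : I -> {set C}) (sz : I -> nat)
    (S : {set I}) : (forall i, F i != finset.set0) ->
  exists D : {set I}, [/\ D \subset S,
    {in D &, forall i j, i != j -> [disjoint F i & F j]%B} &
    forall i, i \in S ->
      exists2 j, j \in D & (sz i <= sz j)%N && ~~ [disjoint F i & F j]%B].
Proof.
move=> F0.
have [m] := ubnP #|S|; elim: m S => // m IHm S Sm.
have [->|/set0Pn[s0 s0S]] := eqVneq S finset.set0.
  by exists finset.set0; split=> [|i j|i]; rewrite ?sub0set // inE.
have [s /= sS smax] := @arg_maxnP _ s0 (fun i => i \in S) sz s0S.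
pose S' := [set i in S | [disjoint F i & F s]%B]%SET.
(* As [F s] is nonempty, [s] itself is discarded, so the induction decreases. *)
have ss : ~~ [disjoint F s & F s]%B.
  by rewrite -setI_eq0 finset.setIid F0.
have S'S : S' \subset (S :\ s)%SET.
  apply/fintype.subsetP => i; rewrite !inE => /andP[iS dis].
  by rewrite iS andbT; apply: contraNneq ss => ist; rewrite ist in dis.
have /IHm[D [DS Ddis Dcov]] : (#|S'| < m)%N.
  rewrite (leq_ltn_trans (subset_leq_card S'S))//.
  by move: Sm; rewrite (cardsD1 s S) sS add1n ltnS.
exists (s |: D)%SET; split.
- apply/fintype.subsetP => i; rewrite !inE => /predU1P[->//|/(fintype.subsetP DS)].
  by rewrite inE => /andP[].
- move=> i j; rewrite !inE => /predU1P[->|iD] /predU1P[->|jD] ij.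
  + by rewrite eqxx in ij.
  + by have := fintype.subsetP DS _ jD; rewrite inE disjoint_sym => /andP[].
  + by have := fintype.subsetP DS _ iD; rewrite inE => /andP[].
  + exact: Ddis.
- move=> i iS; have [dis|ndis] := boolP [disjoint F i & F s]%B; last first.
    by exists s; rewrite ?inE ?eqxx// ndis andbT; exact: smax.
  have [|j jD jP] := Dcov i; first by rewrite inE iS.
  by exists j => //; rewrite inE jD orbT.
Qed.

(** Only the corners in [S] have to be counted, not their whole tiles. If the tile at [t] meets a
    selected tile at [s] that is at least as large, then [t] lies in [[s - sz s, s + sz s)]; hence a
    factor 2 per dimension instead of 3. *)
Lemma vitali_tiles (sz : cell -> nat) (S : {set cell}) :
  (forall t, (0 < sz t)%N) ->
  exists D : {set cell}, [/\ D \subset S,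
    {in D &, forall s t : cell, s != t ->
       [disjoint tile n (fun i => s i) (sz s) & tile n (fun i => t i) (sz t)]%B} &
    (#|S| <= \sum_(s in D) (sz s).*2 ^ d)%N].
Proof.
move=> sz0; pose F (t : cell) := tile n (fun i => t i) (sz t).
have [|D [DS Ddis Dcov]] := @greedy_disjoint _ _ F sz S.
  move=> t; apply/set0Pn; exists t; rewrite inE; apply/forallP => i.
  by have := sz0 t; lia.
exists D; split=> //.
(* The subtraction is truncated: if [s i < sz s], the tile starts at 0 and still reaches past
   [s i + sz s]. *)
pose N (s : cell) := tile n (fun i => s i - sz s)%N (sz s).*2.
have SN : S \subset (\bigcup_(s in D) N s)%SET.
  apply/fintype.subsetP => t /Dcov[s sD /andP[ts]].
  rewrite -setI_eq0 => /set0Pn[k]; rewrite !inE => /andP[/forallP kt /forallP ks].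
  apply/finset.bigcupP; exists s => //; rewrite inE; apply/forallP => i.
  by have := kt i; have := ks i; lia.
apply: (leq_trans (subset_leq_card SN)).
elim/big_rec2: _ => [|s m A sD Am]; first by rewrite cards0.
rewrite (leq_trans (leq_card_setU _ _))// leq_add//.
exact: card_tile_le.
Qed.

End tile_cover.

(** * Covers over a region *)

Section covers.
Variables (R : realType) (d : nat) (X : metricType R).
Variables (T : 'rV[R]_d -> X -> X) (eps : R).
Hypothesis T_action : continuous_action T.
Hypothesis eps_gt0 : 0 < eps.

(* The weight [p.2] of a member [p] is a logarithm: with [psi] equal to
   [ln (1 / eps)] times the potential this bounds [cover_cost], and with [psi]
   equal to 0 it bounds the number of nonempty members. *)
Definition coverable (D : set 'rV[R]_d) (psi : X -> R) (E : set X) (c : R) :=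
  exists r (s : seq (set X * R)), [/\ r < eps,
    forall p, p \in s -> [/\ open p.1,
      forall x y u, p.1 x -> p.1 y -> D u -> mdist (T u x) (T u y) <= r &
      forall y, p.1 y -> psi y <= p.2],
    forall x, E x -> exists2 p, p \in s & p.1 x &
    \sum_(p <- s) expR p.2 <= c].

Lemma coverable_ge0 D psi E c : coverable D psi E c -> 0 <= c.
Proof.
by move=> [r [s [_ _ _ sc]]]; rewrite (le_trans _ sc)// sumr_ge0// => p _;
  exact: expR_ge0.
Qed.

Lemma coverable_ge D psi E c x : coverable D psi E c -> E x ->
  expR (psi x) <= c.
Proof.
move=> [r [s [_ sP sE sc]]] /sE[p ps px]; rewrite (le_trans _ sc)//.
rewrite (big_rem p)//= (@le_trans _ _ (expR p.2))//.
  by rewrite ler_expR; have [_ _] := sP _ ps; apply.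
by rewrite lerDl sumr_ge0// => q _; exact: expR_ge0.
Qed.

Lemma coverableS D D' (psi psi' : X -> R) E E' c c' :
  D' `<=` D -> (forall x, psi' x <= psi x) -> E' `<=` E -> c <= c' ->
  coverable D psi E c -> coverable D' psi' E' c'.
Proof.
move=> DD pp EE cc [r [s [re sP sE sc]]]; exists r, s; split=> //.
- move=> p /sP[po pr pw]; split=> // [x y u px py /DD Du|y py].
    exact: pr.
  by rewrite (le_trans (pp y))// pw.
- by move=> x /EE; exact: sE.
- exact: le_trans sc cc.
Qed.

Lemma coverableD D psi E c k :
  coverable D psi E c -> coverable D (fun x => psi x + k) E (c * expR k).
Proof.
move=> [r [s [re sP sE sc]]].
exists r, [seq (p.1, p.2 + k) | p <- s]; split=> //.
- move=> _ /mapP[p /sP[po pr pw] ->]; split=> //= y py.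
  by rewrite lerD2r pw.
- by move=> x /sE[p ps px]; exists (p.1, p.2 + k) => //; exact: map_f.
- rewrite big_map; under eq_bigr do rewrite expRD.
  by rewrite -mulr_suml ler_wpM2r// expR_ge0.
Qed.

Lemma coverable_set0 E : coverable set0 (fun=> 0) E 1.
Proof.
exists 0, [:: (setT, 0)]; split=> //.
- by move=> p; rewrite inE => /eqP ->; split=> //=; exact: openT.
- by move=> x _; exists (setT, 0); rewrite ?inE.
- by rewrite big_seq1 expR0.
Qed.

(** The pairwise intersections of members form the cover. Weights add, so the sum of exponentials
    factors into the two given sums. *)
Lemma coverableU D D' psi psi' E c c' :
  coverable D psi E c -> coverable D' psi' E c' ->
  coverable (D `|` D') (fun x => psi x + psi' x) E (c * c').
Proof.
move=> cD cD'; have c0 := coverable_ge0 cD; have c'0 := coverable_ge0 cD'.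
move: cD cD' => [r [s [re sP sE sc]]] [r' [s' [re' sP' sE' sc']]].
exists (Num.max r r'), [seq (p.1 `&` q.1, p.2 + q.2) | p <- s, q <- s'].
split.
- by rewrite gt_max re re'.
- move=> _ /allpairsP[[p q] [/= /sP[po pr pw] /sP'[qo qr qw] ->]] /=; split.
  + exact: openI.
  + move=> x y u [px qx] [py qy] [Du|Du]; rewrite le_max.
      by rewrite pr.
    by rewrite qr ?orbT.
  + by move=> y [py qy]; rewrite lerD ?pw ?qw.
- move=> x Ex; have [p ps px] := sE x Ex; have [q qs qx] := sE' x Ex.
  exists (p.1 `&` q.1, p.2 + q.2) => //.
  by apply/allpairsP; exists (p, q).
- rewrite big_allpairs_dep/=.
  under eq_bigr do under eq_bigr do rewrite expRD.
  under eq_bigr do rewrite -mulr_sumr.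
  by rewrite -mulr_suml ler_pM// sumr_ge0// => p _; exact: expR_ge0.
Qed.

(** The members are pulled back by [T v], using [T u = T (u - v) (T v)]. *)
Lemma coverable_shift D psi E c v : coverable D psi E c ->
  coverable [set u | D (u - v)] (psi \o T v) (T v @^-1` E) c.
Proof.
move=> [r [s [re sP sE sc]]].
have [_ TD _] := T_action.
exists r, [seq (T v @^-1` p.1, p.2) | p <- s]; split=> //.
- move=> _ /mapP[p /sP[po pr pw] ->]; split=> /=.
  + by apply: open_comp => // x _; exact: continuous_act.
  + move=> x y u px py Du; rewrite -(subrK v u) (TD _ _ x) (TD _ _ y); exact: pr.
  + by move=> y; exact: pw.
- move=> x /sE[p ps px]; exists (T v @^-1` p.1, p.2) => //.
  by apply/mapP; exists p.
- by rewrite big_map.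
Qed.

End covers.

(** * Covers weighted by orbit integrals over unions of cells *)

Section orbit_covers.
Variables (R : realType) (d : nat) (X : metricType R).
Variables (T : 'rV[R]_d -> X -> X) (phi : X -> R) (H eps kappa : R).
Hypothesis T_action : continuous_action T.
Hypothesis phi_continuous : continuous phi.
Hypothesis phi_le : forall x, `|phi x| <= H.
Hypothesis eps_gt0 : 0 < eps.

(** [kappa] stays free: [ln (1 / eps)] yields the costs in [cover_cost], while 0 serves to count
    Bowen balls. *)
Definition orbit_coverable (D : set 'rV[R]_d) :=
  coverable T eps D (fun x => kappa * orbit_integral T phi D x).

Section region_covers.
Variables (n : nat) (M : R).
Hypothesis M_gt0 : 0 < M.
Notation cell := {ffun 'I_d -> 'I_n}.

Lemma orbit_coverableU (A B : {set cell}) E c c' : [disjoint A & B]%B ->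
  orbit_coverable (region M A) E c -> orbit_coverable (region M B) E c' ->
  orbit_coverable (region M (A :|: B)) E (c * c').
Proof.
move=> AB cA cB; have := coverableU cA cB.
apply: coverableS => // [|x]; first by rewrite regionU.
rewrite regionU (orbit_integralU T_action phi_continuous phi_le).
- by rewrite mulrDr.
- exact: finite_volume_region.
- exact: finite_volume_region.
- exact: region_disjoint.
Qed.

Lemma orbit_coverable_bigcup (I : finType) (J : {set I}) (F : I -> {set cell})
    (c : I -> R) E :
  {in J &, forall i j, i != j -> [disjoint F i & F j]%B} ->
  (forall i, i \in J -> orbit_coverable (region M (F i)) E (c i)) ->
  orbit_coverable (region M (\bigcup_(i in J) F i)%SET) E (\prod_(i in J) c i).
Proof.
have [m] := ubnP #|J|; elim: m J => // m IHm J Jm Jdis Jc.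
have [->|/set0Pn[i iJ]] := eqVneq J finset.set0.
  rewrite !big_set0; have := @coverable_set0 _ _ _ T eps eps_gt0 E.
  have r0 : region M (finset.set0 : {set cell}) = set0 :> set 'rV[R]_d.
    by apply/seteqP; split=> [u [k]|u []]; rewrite inE.
  apply: coverableS => // [|x]; first by rewrite r0.
  rewrite r0 /orbit_integral preimage_set0 Rintegral_set0 mulr0//.
rewrite (big_setD1 i)//= [X in orbit_coverable _ _ X](big_setD1 i)//=.
apply: orbit_coverableU; [|exact: Jc|apply: IHm].
- apply: finset.bigcup_disjoint => j; rewrite !inE => /andP[ji jJ].
  by apply: Jdis => //; rewrite eq_sym.
- by move: Jm; rewrite (cardsD1 i J) iJ add1n ltnS.
- by move=> j k; rewrite !inE => /andP[_ jJ] /andP[_ kJ]; exact: Jdis.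
- by move=> j; rewrite !inE => /andP[_ jJ]; exact: Jc.
Qed.

(** The region of a tile is a translate of a cube, and both the cover and the orbit integral are
    transported by the action of its corner. *)
Lemma orbit_coverable_tile (t : 'I_d -> nat) (l : nat) E c :
  (forall i, (t i + l <= n)%N) ->
  orbit_coverable (cube (M * l%:R)) E c ->
  orbit_coverable (region M (tile n t l)) (T (corner M t) @^-1` E) c.
Proof.
move=> tl cE; rewrite region_tile//.
have := coverable_shift T_action (corner M t) cE.
apply: coverableS => // x /=.
rewrite (orbit_integral_shift T_action phi_continuous phi_le)//.
by apply: finite_volume_cube; rewrite mulr_ge0// ltW.
Qed.

End region_covers.
End orbit_covers.

(** * Comparison with [cover_cost] *)

Lemma mdist_le_mdist (R : realType) (X : metricType R) (x y x' y' : X) :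
  mdist x y <= mdist x x' + mdist x' y' + mdist y y'.
Proof.
rewrite (le_trans (metric_triangle x x' y))// -addrA lerD2l.
by rewrite (le_trans (metric_triangle x' y' y))// lerD2l metric_sym.
Qed.

Lemma near_mdist_lt (R : realType) (X : metricType R) (x : X) (e : R) :
  0 < e -> \forall y \near x, mdist x y < e.
Proof.
by move=> e0; apply: filterS (nbhsx_ballx x e e0) => y; rewrite ballEmdist.
Qed.

(** Compactness enters in its near-covering form, here and below: if a property of [(N, x)] holds
    for large [N] locally uniformly near each point, then one [N] serves all points. *)
Lemma compact_mdist_bounded (R : realType) (X : metricType R) :
  compact [set: X] -> exists D : R, forall x y : X, mdist x y <= D.
Proof.
move=> cX; have [[x0 _]|X0] := pselect ([set: X] !=set0); last first.
  by exists 0 => x; exfalso; apply: X0; exists x.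
have [N [_ NP]] : \forall N \near +oo, [set: X] `<=` (fun x => mdist x0 x <= N).
  have := (compact_near_coveringP [set: X]).1 cX R +oo
    (fun N x => mdist x0 x <= N) _; apply => x _.
  exists ([set y | mdist x y < 1], [set N | mdist x0 x + 1 < N]).
    split => /=; first exact: near_mdist_lt.
    by apply: nbhs_pinfty_gt; exact: num_real.
  move=> [y N] [/= xy xN]; rewrite (le_trans (metric_triangle x0 x y))//.
  by rewrite (le_trans _ (ltW xN))// lerD2l ltW.
have {}NP x : mdist x0 x <= N + 1 by apply: NP; rewrite // ltrDl.
exists ((N + 1) + (N + 1)) => x y.
by rewrite (le_trans (metric_triangle x x0 y))// lerD// metric_sym.
Qed.

Lemma compact_fun_bounded (R : realType) (X : metricType R) (f : X -> R) :
  compact [set: X] -> continuous f -> exists H : R, forall x, `|f x| <= H.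
Proof.
move=> cX cf.
have [N [_ NP]] : \forall N \near +oo, [set: X] `<=` (fun x => `|f x| <= N).
  have := (compact_near_coveringP [set: X]).1 cX R +oo
    (fun N x => `|f x| <= N) _; apply => x _.
  exists ([set y | `|f x - f y| < 1], [set N | `|f x| + 1 < N]).
    split => /=; last by apply: nbhs_pinfty_gt; exact: num_real.
    exact: (cvgr_dist_lt _ _ (cf x) _ ltr01).
  move=> [y N] [/= xy xN]; rewrite (le_trans _ (ltW xN))//.
  by have := ler_normB (f x) (f x - f y); rewrite opprB addrC subrK; lra.
by exists (N + 1) => x; apply: NP; rewrite // ltrDl.
Qed.

Section cover_cost.
Variables (R : realType) (d : nat) (X : metricType R).
Variables (T : 'rV[R]_d -> X -> X) (phi : X -> R) (H eps : R).
Hypothesis X_compact : compact [set: X].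
Hypothesis T_action : continuous_action T.
Hypothesis phi_continuous : continuous phi.
Hypothesis phi_le : forall x, `|phi x| <= H.
Hypotheses (eps_gt0 : 0 < eps) (eps_lt1 : eps < 1).

Let kappa := ln (1 / eps).

Lemma ln_inv_gt0 : 0 < ln (1 / eps).
Proof. by rewrite ln_gt0// ltr_pdivlMr// mul1r. Qed.

Lemma powR_inv x : (1 / eps) `^ x = expR (kappa * x).
Proof. by rewrite /powR gt_eqF ?divr_gt0// mulrC. Qed.

Lemma coverable_of_cover_cost E L c : 0 < L ->
  (cover_cost T phi E L eps < c%:E)%E ->
  orbit_coverable T phi eps kappa (cube L) E c.
Proof.
move=> L0 /ereal_inf_lt[_ [n [U [oU dU EU ->]]]]; rewrite lte_fin => Uc.
have [D XD] := compact_mdist_bounded X_compact.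
have cube0 : cube L (0 : 'rV[R]_d) by move=> i; rewrite mxE lexx.
(* A real [sup] dominates the elements only of a bounded set, so each of the three suprema needs its
   bound. *)
have ubT x y : has_ubound [set mdist (T u x) (T u y) | u in cube L].
  by exists D => _ [u _ <-]; exact: XD.
have dle x y u : cube L u -> mdist (T u x) (T u y) <= dist_cube T L x y.
  by move=> Lu; apply: ub_le_sup => //; exists u.
have dD x y : dist_cube T L x y <= D.
  by apply: ge_sup; [exists (mdist (T 0 x) (T 0 y)), 0|move=> _ [u _ <-]].
have ubp i : has_ubound (potential_cube T phi L @` U i).
  exists (H * volume (@cube R d L)) => _ [x _ <-].
  apply: le_trans (ler_norm _) _.
  apply: (orbit_integral_norm_le T_action phi_continuous phi_le).
  by apply: finite_volume_cube; exact: ltW.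
(* The largest of finitely many diameters is still strictly below [eps]; the initial value 0 uses
   [0 < eps]. *)
exists (\big[Num.max/0]_(i < n) diam (dist_cube T L) (U i)).
exists [seq (U i, kappa * sup (potential_cube T phi L @` U i)) | i <- enum 'I_n].
split.
- by apply/bigmax_ltP; split=> // i _; exact: dU.
- move=> _ /mapP[i _ ->]; split => //=.
  + move=> x y u Ux Uy Lu; rewrite (le_trans (dle x y u Lu))//.
    rewrite (le_trans _ (le_bigmax _ _ i))//.
    apply: ub_le_sup; last by exists x => //; exists y.
    by exists D => _ [x' _ [y' _ <-]].
  + move=> y Uy; rewrite ler_pM2l ?ln_inv_gt0//.
    by apply: ub_le_sup => //; exists y.
- move=> x /EU[i _ Ux].
  exists (U i, kappa * sup (potential_cube T phi L @` U i)) => //.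
  by apply: map_f; rewrite mem_enum.
- rewrite big_map big_enum/= ltW//.
  by under eq_bigr do rewrite -powR_inv.
Qed.

Lemma cover_cost_of_coverable E L c : 0 < L ->
  orbit_coverable T phi eps kappa (cube L) E c ->
  (cover_cost T phi E L eps <= c%:E)%E.
Proof.
move=> L0 [r [s [re sP sE sc]]].
have cube0 : cube L (0 : 'rV[R]_d) by move=> i; rewrite mxE lexx.
(* Empty members are dropped: since [sup set0 = 0], each would cost 1, possibly more than its weight
   allows. *)
pose s' := [seq p <- s | `[< p.1 !=set0 >]].
have s'P (i : 'I_(size s')) : let p := tnth (in_tuple s') i in
    p \in s /\ p.1 !=set0.
  have := mem_tnth i (in_tuple s').
  by rewrite mem_filter => /andP[/asboolP p0 ps].
have : (\sum_(i < size s') (1 / eps) `^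
    sup (potential_cube T phi L @` (tnth (in_tuple s') i).1) <= c).
  apply: le_trans sc.
  rewrite (@le_trans _ _ (\sum_(p <- s') expR p.2))//.
    rewrite (big_tnth _ _ s')/=; apply: ler_sum => i _.
    have [ps [x px]] := s'P i.
    rewrite powR_inv ler_expR -ler_pdivlMl ?ln_inv_gt0//.
    apply: ge_sup; first by exists (potential_cube T phi L x), x.
    move=> _ [y py <-]; rewrite ler_pdivlMl ?ln_inv_gt0//.
    by have [_ _] := sP _ ps; apply.
  rewrite big_filter big_mkcond/=; apply: ler_sum => p _.
  by case: ifP => // _; exact: expR_ge0.
rewrite -lee_fin; apply: le_trans; apply: ereal_inf_lbound.
exists (size s'), (fun i => (tnth (in_tuple s') i).1); split => //.
- by move=> i; have [ps _] := s'P i; have [] := sP _ ps.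
- move=> i; have [ps [x px]] := s'P i; have [_ pr _] := sP _ ps.
  apply: le_lt_trans re; apply: ge_sup.
    by exists (dist_cube T L x x), x => //; exists x.
  move=> _ [y py [z pz <-]]; apply: ge_sup.
    by exists (mdist (T 0 y) (T 0 z)), 0.
  by move=> _ [u Lu <-]; exact: pr.
- move=> x /sE[p ps px].
  have ps' : p \in s' by rewrite mem_filter ps andbT; apply/asboolP; exists x.
  have /(tnthP (in_tuple s'))[i pE] : p \in in_tuple s' by [].
  by exists i => //; rewrite -pE.
Qed.

End cover_cost.

(** * Pressure and upper and lower limits *)

Section limits.
Variables (R : realType).
Local Open Scope ereal_scope.

(** The slack [e] is arbitrary but fixed along the filter; it will absorb the term
    [log c / log (1 / eps)]. *)
Lemma limf_esup_le (F : set_system R) (f g : R -> \bar R) : Filter F ->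
  (forall e : R, (0 < e)%R -> \forall x \near F, f x <= g x + e%:E) ->
  limf_esup f F <= limf_esup g F.
Proof.
move=> FF fg; apply/lee_addgt0Pr => e e0; rewrite -leeBlDr//.
rewrite (limf_esupE g); apply: le_ereal_inf_tmp => _ [V FV <-].
rewrite leeBlDr// limf_esupE.
have FW := filterI FV (fg e e0).
apply: (@le_trans _ _ (ereal_sup (f @` (V `&` [set x | f x <= g x + e%:E])))).
  by apply: ereal_inf_lbound; eexists; [exact: FW|].
apply: ge_ereal_sup => _ [x [Vx fgx] <-]; rewrite (le_trans fgx)// leeD2r//.
by apply: ereal_sup_ubound; exists x.
Qed.

Lemma limf_einf_le (F : set_system R) (f g : R -> \bar R) : Filter F ->
  (forall e : R, (0 < e)%R -> \forall x \near F, f x <= g x + e%:E) ->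
  limf_einf f F <= limf_einf g F.
Proof.
move=> FF fg; rewrite /limf_einf leeN2; apply: limf_esup_le => e e0.
apply: filterS (fg e e0) => x fgx.
by rewrite -[X in _ + X]oppeK -fin_num_oppeD// leeN2 leeBlDr.
Qed.

(** Infinite values are included: for [S = -oo] every real [q] is allowed, which forces
    [P = -oo]. *)
Lemma lee_addC_of_gt (P S : \bar R) (C : R) :
  (forall q : R, S < q%:E -> P <= (q + C)%:E) -> P <= S + C%:E.
Proof.
case: S => [s| |] PS.
- apply/lee_addgt0Pr => e e0; have := PS (s + e)%R.
  by rewrite lte_fin ltrDl e0 -!EFinD -addrA [(e + C)%R]addrC addrA; apply.
- by rewrite addye// leey.
- case: P PS => [p| |] PS //.
  + by exfalso; have := PS (p - 1 - C)%R (ltNyr _); rewrite subrK lee_fin; lra.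
  + by have := PS 0%R (ltNyr _).
Qed.

End limits.

Section pressure.
Variables (R : realType) (d : nat) (X : metricType R).
Variables (T : 'rV[R]_d -> X -> X) (phi : X -> R) (eps : R).

Lemma ln2_gt0 : 0 < ln 2 :> R.
Proof. by rewrite ln_gt0// ltr1n. Qed.

Lemma cover_cost_ge0 E L : (0 <= cover_cost T phi E L eps)%E.
Proof.
apply: le_ereal_inf_tmp => _ [n [U [_ _ _ ->]]].
by rewrite lee_fin sumr_ge0// => i _; exact: powR_ge0.
Qed.

(** Rates are base 2 logarithms per volume, whereas covers are weighted by [expR]; hence the factors
    [ln 2] in the exponents below. *)
Lemma rateE (c : \bar R) (L : R) : 0 < L ->
  (log2e c * ((L ^+ d)^-1)%:E * (ln 2 * L ^+ d)%:E = lne c)%E.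
Proof.
move=> L0; rewrite /log2e -!muleA -!EFinM.
rewrite (_ : _ * _ = 1) ?mule1//; field.
by rewrite !gt_eqF ?exprn_gt0 ?ln2_gt0.
Qed.

Lemma rate_gt0 (L : R) : 0 < L -> (0 < (ln 2 * L ^+ d)%:E)%E.
Proof. by move=> L0; rewrite lte_fin mulr_gt0 ?ln2_gt0 ?exprn_gt0. Qed.

Lemma rate_ge (c : \bar R) (L q : R) : 0 < L ->
  ((expR (q * ln 2 * L ^+ d))%:E <= c)%E ->
  (q%:E <= log2e c * ((L ^+ d)^-1)%:E)%E.
Proof.
move=> L0 qc; rewrite -(lee_pmul2r _ (rate_gt0 L0))// rateE// -EFinM mulrA.
rewrite -[leLHS]expeRK lee_lne// in_itv/= leey andbT ?expeR_ge0//.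
by rewrite (le_trans _ qc)// lee_fin expR_ge0.
Qed.

Lemma rate_le (c : \bar R) (L q : R) : 0 < L -> (0 <= c)%E ->
  (c <= (expR (q * ln 2 * L ^+ d))%:E)%E ->
  (log2e c * ((L ^+ d)^-1)%:E <= q%:E)%E.
Proof.
move=> L0 c0 qc; rewrite -(lee_pmul2r _ (rate_gt0 L0))// rateE// -EFinM mulrA.
by rewrite -[leRHS]expeRK lee_lne// in_itv/= ?c0 ?leey // lee_fin expR_ge0.
Qed.

Lemma cover_cost_lt_of_pressure E q : (pressure T phi E eps < q%:E)%E ->
  forall L0, exists2 L, 0 < L /\ L0 < L &
    (cover_cost T phi E L eps < (expR (q * ln 2 * L ^+ d))%:E)%E.
Proof.
rewrite /pressure limf_einfE => Pq L0.
have V : pinfty_nbhs R [set L | Num.max 0 L0 < L].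
  by exists (Num.max 0 L0); split; [exact: num_real|].
have : (ereal_inf ((fun L => log2e (cover_cost T phi E L eps) *
    ((L ^+ d)^-1)%:E) @` [set L | (Num.max 0 L0 < L)%R]) < q%:E)%E.
  by apply: le_lt_trans Pq; apply: ereal_sup_ubound; eexists; [exact: V|].
move=> /ereal_inf_lt[_ [L /= + <-]]; rewrite gt_max => /andP[L_gt0 L0L] Lq.
exists L => //; move: Lq; rewrite !ltNge; apply: contra => cL.
by rewrite rate_ge.
Qed.

(** For a lower limit an unbounded set of sides [L] suffices; later these are multiples of a fixed
    side. *)
Lemma pressure_le_of_cover_cost E q :
  (forall L0, exists2 L, 0 < L /\ L0 < L &
    (cover_cost T phi E L eps <= (expR (q * ln 2 * L ^+ d))%:E)%E) ->
  (pressure T phi E eps <= q%:E)%E.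
Proof.
move=> Pq; rewrite /pressure limf_einfE; apply: ge_ereal_sup => _ [V [M [_ MV]] <-].
have [L [L_gt0 ML] Lq] := Pq M.
apply: (@le_trans _ _ (log2e (cover_cost T phi E L eps) * ((L ^+ d)^-1)%:E)%E).
  by apply: ereal_inf_lbound; exists L => //; exact: MV.
by rewrite rate_le// cover_cost_ge0.
Qed.

Lemma le_cover_cost E E' L : E `<=` E' ->
  (cover_cost T phi E L eps <= cover_cost T phi E' L eps)%E.
Proof.
move=> EE'; apply: le_ereal_inf => _ [n [U [oU dU EU ->]]].
by exists n, U; split=> //; exact: subset_trans EE' EU.
Qed.

Lemma le_pressure E E' : E `<=` E' ->
  (pressure T phi E eps <= pressure T phi E' eps)%E.
Proof.
move=> EE'; rewrite /pressure !limf_einfE; apply: ge_ereal_sup => _ [V FV <-].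
have FW : pinfty_nbhs R (V `&` [set L | 0 < L]).
  by apply: filterI => //; exact: nbhs_pinfty_gt.
apply: (@le_trans _ _ (ereal_inf ((fun L => log2e (cover_cost T phi E' L eps) *
    ((L ^+ d)^-1)%:E)%E @` (V `&` [set L | 0 < L])))); last first.
  by apply: ereal_sup_ubound; eexists; [exact: FW|].
apply: le_ereal_inf_tmp => _ [L [VL /= L0] <-].
apply: (@le_trans _ _ (log2e (cover_cost T phi E L eps) * ((L ^+ d)^-1)%:E)%E).
  by apply: ereal_inf_lbound; exists L.
apply: lee_wpmul2r; first by rewrite lee_fin invr_ge0 exprn_ge0// ltW.
apply: lee_wpmul2r; first by rewrite lee_fin invr_ge0 ltW// ln2_gt0.
by rewrite lee_lne ?in_itv/= ?cover_cost_ge0 ?leey// le_cover_cost.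
Qed.

End pressure.

(** * Consequences of compactness *)

(** The closed Bowen ball over [D]; for [D = setT] it is [orbit_ball]. *)
Definition local_ball (R : realType) (d : nat) (X : metricType R)
    (T : 'rV[R]_d -> X -> X) (delta : R) (D : set 'rV[R]_d) (x : X) : set X :=
  [set y | forall u, D u -> mdist (T u x) (T u y) <= delta].

(** Centred at 0, so that these cubes exhaust R^d; the cubes [cube L] fill only an orthant. *)
Definition sym_cube (R : realType) (d : nat) (N : R) : set 'rV[R]_d :=
  [set u | forall i, `|u ord0 i| <= N].

(* [compact_cover] is only available for pointed spaces. *)
Lemma compact_finite_subcover (X : topologicalType) (U : X -> set X) :
  compact [set: X] -> (forall x, nbhs x (U x)) ->
  exists s : seq X, forall y, exists2 x, x \in s & U x y.
Proof.
move=> cX nU.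
(* Along [F], a property holds eventually if it holds for all lists containing some fixed list;
   near-covering then yields one list good for every point. *)
pose F := filter_from [set: seq X] (fun s0 => [set s : seq X | {subset s0 <= s}]).
have FF : Filter F.
  apply: filter_from_filter; first by exists [::].
  move=> s1 s2 _ _; exists (s1 ++ s2) => // s s12.
  by split=> x xs; apply: s12; rewrite mem_cat xs ?orbT.
have [s0 _ s0P] : \forall s \near F,
    [set: X] `<=` (fun y => exists2 x, x \in s & U x y).
  apply: ((compact_near_coveringP _).1 cX (seq X) F
    (fun s y => exists2 x, x \in s & U x y) FF) => x _.
  exists (U x, [set s : seq X | x \in s]) => /=.
    by split=> //; exists [:: x] => // s xs; apply: xs; rewrite mem_head.
  by move=> [y s] /= [Uxy xs]; exists x.
by exists s0 => y; exact: (s0P s0).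
Qed.

Section compactness.
Variables (R : realType) (d : nat) (X : metricType R).
Variables (T : 'rV[R]_d -> X -> X).
Hypothesis X_compact : compact [set: X].
Hypothesis T_action : continuous_action T.

Lemma compact_closed_cube (L : R) :
  compact [set u : 'rV[R]_d | forall i, `[0, L]%classic (u ord0 i)].
Proof.
by apply: (@rV_compact _ _ (fun=> `[0, L]%classic)) => _; exact: segment_compact.
Qed.

Lemma near_orbit (u : 'rV[R]_d) (x : X) (e : R) : 0 < e ->
  \forall v \near u & y \near x, mdist (T u x) (T v y) < e.
Proof.
move=> e0; have [_ _ cT] := T_action.
have := cT (u, x) _ (near_mdist_lt (T u x) e0).
by rewrite nbhs_simpl/= => -[[A B] /= [nA nB] AB]; exists (A, B).
Qed.

(** Joint continuity gives the bound near each [(u, x)]; compactness of the closed cube makes the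
    neighbourhood of [x] uniform in [u]. *)
Lemma near_dist_cube (L e : R) (x : X) : 0 < e ->
  \forall y \near x, forall u, cube L u -> mdist (T u x) (T u y) <= e.
Proof.
move=> e0.
suff : \forall y \near x, [set u : 'rV[R]_d | forall i, `[0, L]%classic (u ord0 i)]
    `<=` (fun u => mdist (T u x) (T u y) <= e).
  apply: filterS => y yP u Lu; apply: yP => i; have /andP[u0 uL] := Lu i.
  by rewrite /= in_itv/= u0 ltW.
apply: ((compact_near_coveringP _).1 (@compact_closed_cube L) X (nbhs x)
  (fun y u => mdist (T u x) (T u y) <= e) _) => u _.
have e20 : 0 < e / 2 by rewrite divr_gt0.
have [[A B] /= [nA nB] AB] := near_orbit u x e20.
exists (A, B) => //= -[v y] /= [Av By].
have vx := AB (v, x) (conj Av (nbhs_singleton nB)).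
have vy := AB (v, y) (conj Av By).
have := metric_triangle (T v x) (T u x) (T v y).
by move: vx vy; rewrite /= [mdist (T v x) (T u x)]metric_sym; lra.
Qed.

Lemma coverable_cube (L e : R) : 0 < e ->
  exists c, coverable T e (cube L) (fun=> 0) [set: X] c.
Proof.
move=> e0; have e30 : 0 < e / 3 by rewrite divr_gt0.
pose U x := interior [set y | forall u, cube L u -> mdist (T u x) (T u y) <= e / 3].
have xU x : U x x by exact: (near_dist_cube L x e30).
have [|D' DU] := compact_finite_subcover X_compact (U := U).
  by move=> x; apply: open_nbhs_nbhs; split; [exact: open_interior|].
(* Members lie in balls of radius [e / 3], so their diameters are at most [2 e / 3 < e]. *)
exists (\sum_(p <- [seq (U x, 0 : R) | x <- D']) expR p.2), (e / 3 + e / 3).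
exists [seq (U x, 0) | x <- D']; split=> //.
- lra.
- move=> _ /mapP[x _ ->]; split=> //=; first exact: open_interior.
  move=> y z u /interior_subset Uy /interior_subset Uz Lu.
  rewrite (le_trans (metric_triangle _ (T u x) _))// lerD ?Uz// metric_sym.
  exact: Uy.
- move=> y _; have [x xD Uxy] := DU y.
  by exists (U x, 0) => //; exact: map_f.
Qed.

(** Each [z] outside [U] is separated from [x] by more than [delta] at some time [u]. This persists
    for nearby points as soon as [sym_cube N] contains [u], and the complement of [U] is compact. *)
Lemma near_local_ball (delta : R) (x : X) (U : set X) :
  open U -> orbit_ball T delta x `<=` U ->
  \forall y \near x & N \near +oo, local_ball T delta (sym_cube N) y `<=` U.
Proof.
move=> oU xU.
have cU : compact (~` U).
  by apply: subclosed_compact X_compact _ => //; exact: open_closedC.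
suff : \forall yN \near filter_prod (nbhs x) (pinfty_nbhs R), ~` U `<=`
    (fun z => exists2 u, sym_cube yN.2 u & delta < mdist (T u yN.1) (T u z)).
  apply: filterS => -[y N] /= yN z yNz; apply: contrapT => /yN[u Nu].
  by rewrite ltNge yNz.
apply: ((compact_near_coveringP _).1 cU (X * R)%type
  (filter_prod (nbhs x) (pinfty_nbhs R))
  (fun yN z => exists2 u, sym_cube yN.2 u & delta < mdist (T u yN.1) (T u z)) _).
move=> z Uz.
have [u uz] : exists u, delta < mdist (T u x) (T u z).
  apply: contrapT => /forallNP h; apply/Uz/xU => u.
  by rewrite leNgt; apply/negP; exact: h.
(* Half of the excess over [delta] may be lost at each of the two points. *)
have e0 : 0 < (mdist (T u x) (T u z) - delta) / 2 by rewrite divr_gt0 // subr_gt0.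
have [[A B] /= [nA nB] AB] := near_orbit u x e0.
have [[A' B'] /= [nA' nB'] AB'] := near_orbit u z e0.
exists (B', B `*` [set N | \sum_(i < d) `|u ord0 i| < N]).
  split=> //=; exists (B, [set N | \sum_(i < d) `|u ord0 i| < N]) => //=.
  by split=> //; apply: nbhs_pinfty_gt; exact: num_real.
move=> [z' [y N]] /= [B'z' [By uN]]; exists u.
  move=> i; rewrite (le_trans _ (ltW uN))// (bigD1 i)//= lerDl.
  by rewrite sumr_ge0.
have uy := AB (u, y) (conj (nbhs_singleton nA) By).
have uz' := AB' (u, z') (conj (nbhs_singleton nA') B'z').
have := mdist_le_mdist (T u x) (T u z) (T u y) (T u z').
by move: uy uz' => /=; lra.
Qed.

Lemma coverable_open (eps : R) D psi (E : set X) c :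
  coverable T eps D psi E c ->
  exists U : set X, [/\ open U, E `<=` U & coverable T eps D psi U c].
Proof.
move=> [r [s [re sP sE sc]]].
exists (\bigcup_(p in [set` s]) p.1); split.
- by apply: bigcup_open => p /sP[].
- by move=> x /sE[p ps px]; exists p.
- by exists r, s; split=> // x [p ps px]; exists p.
Qed.

(** A cover of an orbit ball also covers the Bowen balls of all nearby centres, by
    [near_local_ball]. Compactness gives one [N] that bounds both the tile sizes and the radius of
    the time window. *)
Lemma coverable_local_ball (eps delta : R) (D : nat -> set 'rV[R]_d)
    (psi : nat -> X -> R) (c : nat -> R) :
  (forall x, exists2 l, (0 < l)%N &
     coverable T eps (D l) (psi l) (orbit_ball T delta x) (c l)) ->
  exists N : nat, forall x, exists2 l, (0 < l <= N)%N &
    coverable T eps (D l) (psi l) (local_ball T delta (sym_cube N%:R) x) (c l).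
Proof.
move=> xP.
have [N [_ NP]] : \forall N \near +oo, [set: X] `<=`
    (fun x => exists2 l, (0 < l)%N /\ l%:R <= N &
       coverable T eps (D l) (psi l) (local_ball T delta (sym_cube N) x) (c l)).
  have := (compact_near_coveringP [set: X]).1 X_compact R +oo (fun N x =>
    exists2 l, (0 < l)%N /\ l%:R <= N & coverable T eps (D l) (psi l)
      (local_ball T delta (sym_cube N) x) (c l)) _; apply => x _.
  have [l l0 /coverable_open[U [oU xU cU]]] := xP x.
  have [[A B] /= [nA nB] AB] := near_local_ball oU xU.
  exists (A, B `&` [set N | l%:R < N]).
    split=> //=; apply: filterI => //; apply: nbhs_pinfty_gt; exact: num_real.
  move=> [y N] /= [Ay [BN lN]]; exists l; first by split=> //; exact: ltW.
  by apply: coverableS cU => //; exact: (AB (y, N)).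
pose m := (Num.truncn `|N|).+1.
have Nm : N < m%:R by rewrite (le_lt_trans (ler_norm N))// truncnS_gt.
exists m => x; have [l [l0 lm] cl] := NP _ Nm x I.
by exists l => //; rewrite l0 -(ler_nat R).
Qed.

End compactness.

(** * Rounding the side of a cube *)

Lemma expr_1D_le (R : realType) (t : R) (d : nat) : 0 <= t -> t <= 1 ->
  (1 + t) ^+ d <= 1 + 2 ^+ d * t.
Proof.
(* The induction carries the sharper chord bound of the convex function [(1 + t) ^+ d] on [0, 1]. *)
move=> t0 t1; suff : (1 + t) ^+ d <= 1 + (2 ^+ d - 1) * t by lra.
elim: d => [|d IHd]; first by rewrite !expr0; lra.
have p0 : 1 <= 2 ^+ d :> R by rewrite exprn_ege1// ler1n.
rewrite !exprS; have t10 : 0 <= 1 + t by lra.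
apply: (le_trans (ler_wpM2l t10 IHd)).
have : 0 <= (2 ^+ d - 1) * t * (1 - t) by rewrite !mulr_ge0//; lra.
by move: (2 ^+ d : R) => p; lra.
Qed.

Section rounding.
Variables (R : realType) (d : nat) (X : metricType R).
Variables (T : 'rV[R]_d -> X -> X) (phi : X -> R) (H eps kappa : R).
Hypothesis T_action : continuous_action T.
Hypothesis phi_continuous : continuous phi.
Hypothesis phi_le : forall x, `|phi x| <= H.
Hypotheses (H_ge0 : 0 <= H) (kappa_ge0 : 0 <= kappa).

Lemma volumeU (D E : set 'rV[R]_d) :
  finite_volume D -> finite_volume E -> [disjoint D & E] ->
  volume (D `|` E) = volume D + volume E.
Proof.
move=> [mD Doo] [mE Eoo] DE; rewrite /volume preimage_setU measureU//.
  by rewrite fineD// ge0_fin_numE.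
move: DE; rewrite disj_set2E => /eqP DE.
by rewrite -(preimage_setI (@row_of_tuple R d)) DE preimage_set0.
Qed.

Lemma orbit_integral_cube_le (L L' : R) (x : X) : 0 <= L' -> L' <= L ->
  orbit_integral T phi (cube L') x <=
    orbit_integral T phi (cube L) x + H * (L ^+ d - L' ^+ d).
Proof.
move=> L'0 L'L; have L0 := le_trans L'0 L'L.
have vL := @finite_volume_cube R d L L0.
have vL' := @finite_volume_cube R d L' L'0.
pose S : set 'rV[R]_d := cube L `\` cube L'.
have sub : cube L' `<=` (cube L : set 'rV[R]_d).
  by move=> u uL i; have /andP[-> uL'] := uL i; exact: lt_le_trans L'L.
have LE : cube L' `|` S = cube L by exact: setDUK.
have dis : [disjoint cube L' & S].
  by rewrite disj_set2E; apply/eqP; exact: setDIK.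
have vS : finite_volume S.
  apply: (@finite_volume_sub _ _ _ (cube L)) => //; last by move=> u [].
  have [mL _] := vL; have [mL' _] := vL'; exact: measurableD mL mL'.
have volS : volume S = L ^+ d - L' ^+ d.
  by rewrite -!volume_cube// -LE volumeU// addrC addKr.
rewrite -LE (orbit_integralU T_action phi_continuous phi_le)//.
have := orbit_integral_norm_le T_action phi_continuous phi_le x vS.
by rewrite volS ler_norml; lra.
Qed.

(** With [l] the integer part of [L / M], shrinking the cube changes the weights by at most
    [kappa * H] and the exponent by at most [|q|], per unit of lost volume. That volume is at most
    [2 ^+ d / l] times the new one, so the gap [q' - q] pays for it once [l] is large. *)
Lemma orbit_coverable_round_down (M : nat) (q q' : R) : (0 < M)%N -> q < q' ->
  exists L0, forall L E, L0 < L ->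
    orbit_coverable T phi eps kappa (cube L) E (expR (q * L ^+ d)) ->
    exists2 l, (0 < l)%N & orbit_coverable T phi eps kappa
      (cube (M%:R * l%:R)) E (expR (q' * (M%:R * l%:R) ^+ d)).
Proof.
move=> M_gt0 qq'; have M0 : 0 < M%:R :> R by rewrite ltr0n.
(* [K <= l] is the condition under which the gap pays. *)
pose K := (`|q| + kappa * H) * 2 ^+ d / (q' - q).
have K0 : 0 <= K.
  rewrite divr_ge0 ?subr_ge0 ?(ltW qq')// mulr_ge0 ?exprn_ge0//.
  by rewrite addr_ge0// mulr_ge0.
(* Rounding down loses less than 1, so [l > K + 1]; in particular [l] is positive. *)
exists (M%:R * (K + 2)) => L E KL cL.
have L0 : 0 < L by apply: lt_trans KL; rewrite mulr_gt0//; lra.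
pose l := Num.truncn (L / M%:R); pose v : R := (M%:R * l%:R) ^+ d.
have LM0 : 0 <= L / M%:R by rewrite divr_ge0// ltW.
have /andP[lL Ll] := truncn_itv LM0; rewrite -/l in lL Ll.
have Kl : K + 1 < l%:R.
  rewrite -natr1 in Ll.
  have : K + 2 < L / M%:R by rewrite ltr_pdivlMr// mulrC.
  lra.
have l_gt0 : (0 < l)%N by rewrite -(ltr_nat R); lra.
have l0 : 0 < l%:R :> R by rewrite ltr0n.
exists l => //.
have v0 : 0 < v by rewrite exprn_gt0// mulr_gt0.
have MlL : M%:R * l%:R <= L by rewrite mulrC -ler_pdivlMr.
have Lv : L ^+ d - v <= v * (2 ^+ d * l%:R^-1).
  suff : L ^+ d <= v * (1 + 2 ^+ d * l%:R^-1) by lra.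
  have l1 : l%:R^-1 <= 1 :> R by rewrite invf_le1// ler1n.
  have l'0 : 0 <= l%:R^-1 :> R by rewrite invr_ge0 ltW.
  apply: le_trans (ler_wpM2l (ltW v0) (expr_1D_le d l'0 l1)); rewrite -exprMn.
  apply: lerXn2r; rewrite ?nnegrE ?(ltW L0)//.
  rewrite mulrDr mulr1 mulfK ?gt_eqF// -[X in _ + X]mulr1 -mulrDr natr1.
  by rewrite mulrC -ler_pdivrMr// ltW.
have Lv0 : 0 <= L ^+ d - v.
  by rewrite subr_ge0; apply: lerXn2r; rewrite ?nnegrE ?(ltW L0)// ltW// mulr_gt0.
have := coverableD (kappa * (H * (L ^+ d - v))) cL.
apply: coverableS => //.
- by move=> u uL i; have /andP[-> uL'] := uL i; exact: lt_le_trans MlL.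
- move=> x; rewrite -mulrDr ler_wpM2l//; apply: orbit_integral_cube_le => //.
rewrite -expRD ler_expR.
have Kle : (`|q| + kappa * H) * (L ^+ d - v) <= (q' - q) * v.
  have C0 : 0 <= `|q| + kappa * H by rewrite addr_ge0// mulr_ge0.
  apply: (le_trans (ler_wpM2l C0 Lv)).
  rewrite [X in _ <= X]mulrC mulrCA ler_pM2l// mulrA ler_pdivrMr//.
  rewrite [X in _ <= X]mulrC -ler_pdivrMr ?subr_gt0//.
  by rewrite -/K; lra.
have : q * (L ^+ d - v) <= `|q| * (L ^+ d - v).
  by rewrite ler_wpM2r// ler_norm.
by move: Kle; rewrite -/v; nra.
Qed.

End rounding.

(** * Tiling a cube *)

Lemma card_disjoint_bigcup (I C : finType) (D : {set I}) (F : I -> {set C}) :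
  {in D &, forall i j, i != j -> [disjoint F i & F j]%B} ->
  #|(\bigcup_(i in D) F i)%SET| = (\sum_(i in D) #|F i|)%N.
Proof.
move=> Fdis; pose G i := if i \in D then F i else finset.set0.
have -> : (\bigcup_(i in D) F i)%SET = (\bigcup_i G i)%SET by rewrite big_mkcond.
rewrite [in RHS]big_mkcond/= -sum1_card.
rewrite (@partition_disjoint_bigcup _ _ _ _ _ G)/=.
  apply: eq_bigr => i _; rewrite sum1_card /G.
  by case: ifP => //; rewrite cards0.
move=> i j ij; rewrite /G; case: ifPn => iD; case: ifPn => jD.
- exact: Fdis.
- by rewrite -setI_eq0 finset.setI0.
- by rewrite -setI_eq0 finset.set0I.
- by rewrite -setI_eq0 finset.set0I.
Qed.

Section tilings.
Variables (R : realType) (d : nat) (X : metricType R).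
Variables (T : 'rV[R]_d -> X -> X) (phi : X -> R) (H eps kappa delta : R).
Hypothesis T_action : continuous_action T.
Hypothesis phi_continuous : continuous phi.
Hypothesis phi_le : forall x, `|phi x| <= H.
Hypothesis eps_gt0 : 0 < eps.
Notation coverable_on := (orbit_coverable T phi eps kappa).

Lemma local_ball_shift (D D' : set 'rV[R]_d) (v : 'rV[R]_d) (x y : X) :
  (forall u, D' u -> D (u + v)) ->
  local_ball T delta D x y -> local_ball T delta D' (T v x) (T v y).
Proof.
by move=> DD xy u Du; have [_ TD _] := T_action; rewrite -!TD; apply/xy/DD.
Qed.

Lemma coverable_tiling (n : nat) (M : R) (D : {set {ffun 'I_d -> 'I_n}})
    (sz : {ffun 'I_d -> 'I_n} -> nat) (c : {ffun 'I_d -> 'I_n} -> R) (E : set X) :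
  0 < M ->
  {in D &, forall s t : {ffun 'I_d -> 'I_n}, s != t ->
    [disjoint tile n (fun i => s i) (sz s) & tile n (fun i => t i) (sz t)]%B} ->
  (forall s : {ffun 'I_d -> 'I_n}, s \in D -> forall i, (s i + sz s <= n)%N) ->
  (forall s : {ffun 'I_d -> 'I_n}, s \in D -> exists2 E' : set X,
     E `<=` T (corner M (fun i => s i)) @^-1` E' &
     coverable_on (cube (M * (sz s)%:R)) E' (c s)) ->
  coverable_on
    (region M (\bigcup_(s in D) tile n (fun i => s i) (sz s))%SET) E
    (\prod_(s in D) c s).
Proof.
move=> M0 Ddis Dn Dc.
apply: (orbit_coverable_bigcup T_action phi_continuous phi_le) => // s sD.
have [E' EE' cE'] := Dc s sD.
have := orbit_coverable_tile T_action phi_continuous phi_le M0 (Dn s sD) cE'.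
exact: coverableS.
Qed.

Lemma coverable_cells (n : nat) (M c : R) (D : {set {ffun 'I_d -> 'I_n}})
    (E : set X) : 0 < M ->
  (forall s : {ffun 'I_d -> 'I_n}, exists2 E' : set X,
     E `<=` T (corner M (fun i => s i)) @^-1` E' &
     coverable_on (cube M) E' c) ->
  coverable_on (region M D) E (c ^+ #|D|).
Proof.
move=> M0 cP.
have := @coverable_tiling n M D (fun=> 1%N) (fun=> c) E M0.
rewrite prodr_const.
have -> : (\bigcup_(s in D) tile n (fun i => s i) 1)%SET = D.
  under eq_bigr do rewrite tile_cell.
  apply/setP => k; apply/finset.bigcupP/idP => [[s sD]|kD].
    by rewrite inE => /eqP ->.
  by exists k; rewrite ?inE.
apply.
- by move=> s t sD tD st; rewrite !tile_cell disjoints1 inE.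
- by move=> s sD i; rewrite addn1.
- by move=> s sD; rewrite mulr1; exact: cP.
Qed.

Lemma coverable_grid (n : nat) (M c : R) (E : set X) : 0 < M ->
  (forall s : {ffun 'I_d -> 'I_n}, exists2 E' : set X,
     E `<=` T (corner M (fun i => s i)) @^-1` E' &
     coverable_on (cube M) E' c) ->
  coverable_on (cube (M * n%:R)) E (c ^+ (n ^ d)).
Proof.
move=> M0 /(coverable_cells (finset.setTfor _) M0).
by rewrite region_setT// cardsT card_ffun !card_ord.
Qed.

(** Seen from the corner of a cell, a Bowen ball over the large cube lies in a Bowen ball over
    [cube M]. Thus a rate valid at side [M] is valid at all multiples of [M]. *)
Lemma local_ball_grid (n : nat) (M c : R) : 0 < M ->
  (forall x, coverable_on (cube M) (local_ball T delta (cube M) x) c) ->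
  forall x, coverable_on (cube (M * n%:R))
    (local_ball T delta (cube (M * n%:R)) x) (c ^+ (n ^ d)).
Proof.
move=> M0 cP x; apply: coverable_grid => // s.
exists (local_ball T delta (cube M) (T (corner M (fun i => s i)) x)) => //.
move=> y; apply: local_ball_shift => u uM i.
have /andP[u0 uM'] := uM i; rewrite !mxE; apply/andP; split.
  by rewrite addr_ge0// mulr_ge0// ltW.
rewrite (@lt_le_trans _ _ (M + M * (s i)%:R)) ?ltrD2r//.
by rewrite -[X in X + _]mulr1 -mulrDr ler_pM2l// nat1r ler_nat.
Qed.

(* The tiles start in [[N, 3N)^d], so that both they and their neighbourhoods of
   radius [N] stay in the cube; this region holds a fraction [2^-d] of the cells,
   and the Vitali selection keeps a further fraction [2^-d]. *)
Lemma local_ball_improve (M N : nat) (q b : R) : (0 < M)%N -> q <= b ->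
  (forall x, exists2 l, (0 < l <= N)%N &
    coverable_on (cube (M%:R * l%:R)) (local_ball T delta (sym_cube N%:R) x)
      (expR (q * (M%:R * l%:R) ^+ d))) ->
  (forall x, coverable_on (cube M%:R) (local_ball T delta (cube M%:R) x)
     (expR (b * M%:R ^+ d))) ->
  forall x, coverable_on (cube (M%:R * (4 * N)%N%:R))
    (local_ball T delta (cube (M%:R * (4 * N)%N%:R)) x)
    (expR ((b - (b - q) / 4 ^+ d) * (M%:R * (4 * N)%N%:R) ^+ d)).
Proof.
move=> M_gt0 qb Nq Mb x; have M0 : 0 < M%:R :> R by rewrite ltr0n.
set n := (4 * N)%N; pose cell := {ffun 'I_d -> 'I_n}.
pose y (t : cell) := T (corner M%:R (fun i => t i)) x.
have [sz szP] : {sz : cell -> nat & forall t, (0 < sz t <= N)%N /\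
    coverable_on (cube (M%:R * (sz t)%:R))
      (local_ball T delta (sym_cube N%:R) (y t))
      (expR (q * (M%:R * (sz t)%:R) ^+ d))}.
  apply: (@choice _ _ (fun t l => (0 < l <= N)%N /\
    coverable_on (cube (M%:R * l%:R)) (local_ball T delta (sym_cube N%:R) (y t))
      (expR (q * (M%:R * l%:R) ^+ d)))) => t.
  by have [l lN cl] := Nq (y t); exists l.
have sz_gt0 t : (0 < sz t)%N by have [/andP[]] := szP t.
have szN t : (sz t <= N)%N by have [/andP[]] := szP t.
have [D [DS Ddis DN]] := vitali_tiles (tile n (fun=> N) (2 * N)) sz_gt0.
have DSP (s : cell) i : s \in D -> (N <= s i < N + 2 * N)%N.
  by move=> /(fintype.subsetP DS); rewrite inE => /forallP/(_ i).
pose A := (\bigcup_(s in D) tile n (fun i => s i) (sz s))%SET.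
have cA : coverable_on (region M%:R A)
    (local_ball T delta (cube (M%:R * n%:R)) x)
    (\prod_(s in D) expR (q * (M%:R * (sz s)%:R) ^+ d)).
  apply: coverable_tiling => // s sD.
    by move=> i; have := DSP s i sD; have := szN s; rewrite /n; lia.
  exists (local_ball T delta (sym_cube N%:R) (y s)); last by case: (szP s).
  move=> z; apply: local_ball_shift => u uN i; rewrite !mxE.
  have := uN i; rewrite ler_norml => /andP[u1 u2].
  have /andP[s1 s2] := DSP s i sD.
  have s1' : M%:R * N%:R <= M%:R * (s i)%:R :> R by rewrite ler_pM2l// ler_nat.
  have s2' : M%:R * (s i)%:R + M%:R <= M%:R * (3 * N)%N%:R :> R.
    by rewrite -[X in _ + X]mulr1 -mulrDr ler_pM2l// natr1 ler_nat; lia.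
  (* The radius [N] is a length, whereas the margin around a tile is [N] cells, of length [M * N];
     [1 <= M] compares the two. *)
  have M1 : 1 <= M%:R :> R by rewrite ler1n.
  have N0 : 0 <= N%:R :> R by rewrite ler0n.
  have MN : N%:R <= M%:R * N%:R :> R by rewrite ler_peMl.
  move: s2'; rewrite /n !natrM => s2'.
  apply/andP; split; first by lra.
  by move: s2' MN; lra.
have cR : coverable_on (region M%:R (~: A)%SET)
    (local_ball T delta (cube (M%:R * n%:R)) x)
    (expR (b * M%:R ^+ d) ^+ #|(~: A)%SET|).
  apply: coverable_cells => // s.
  exists (local_ball T delta (cube M%:R) (y s)) => // z.
  apply: local_ball_shift => u uM i.
  have /andP[u0 uM'] := uM i; rewrite !mxE; apply/andP; split.
    by rewrite addr_ge0// mulr_ge0// ltW.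
  rewrite (@lt_le_trans _ _ (M%:R + M%:R * (s i)%:R)) ?ltrD2r//.
  by rewrite -[X in X + _]mulr1 -mulrDr ler_pM2l// nat1r ler_nat.
have := orbit_coverableU T_action phi_continuous phi_le M0 _ cA cR.
rewrite finset.setUCr region_setT// -setI_eq0 finset.setICr eqxx => /(_ isT).
apply: coverableS => //.
have cardA : #|A| = (\sum_(s in D) sz s ^ d)%N.
  rewrite card_disjoint_bigcup//; apply: eq_bigr => s sD.
  apply: card_tile => i; have /andP[_ s2] := DSP s i sD.
  by rewrite (leq_trans (leq_add (ltnW s2) (szN s)))// /n; lia.
(* The [(2 * N) ^ d] starting cells number at most [2 ^ d * #|A|] by the Vitali selection; [2 ^ d]
   cancels. *)
have NA : (N ^ d <= #|A|)%N.
  move: DN; rewrite card_tile; last by move=> _; rewrite /n; lia.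
  under eq_bigr do rewrite -mul2n expnMn.
  by rewrite -big_distrr/= -cardA expnMn leq_pmul2l// expn_gt0.
have cardC : (#|A| + #|(~: A)%SET| = n ^ d)%N.
  by rewrite cardsC card_ffun !card_ord.
rewrite -expRM_natl -expR_sum -expRD ler_expR.
under eq_bigr do rewrite exprMn mulrA -[(sz _)%:R ^+ _]natrX.
rewrite -mulr_sumr -natr_sum -cardA.
have -> : #|(~: A)%SET|%:R = n%:R ^+ d - #|A|%:R :> R.
  by rewrite -natrX -cardC natrD addrAC subrr add0r.
rewrite exprMn.
have n4 : n%:R ^+ d = 4 ^+ d * N%:R ^+ d :> R by rewrite /n natrM exprMn.
have p4 : 0 < 4 ^+ d :> R by rewrite exprn_gt0.
(* The cost exponent is [M ^ d] times [q #|A| + b (n ^ d - #|A|)], and [#|A|] is at least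
   [N ^ d = n ^ d / 4 ^ d]. *)
have -> : (b - (b - q) / 4 ^+ d) * (M%:R ^+ d * n%:R ^+ d) =
  M%:R ^+ d * (b * n%:R ^+ d - (b - q) * N%:R ^+ d).
  by rewrite n4; field; rewrite gt_eqF.
have Md0 : 0 < M%:R ^+ d :> R by rewrite exprn_gt0.
have : 0 <= M%:R ^+ d * ((b - q) * (#|A|%:R - N%:R ^+ d)).
  rewrite mulr_ge0 ?(ltW Md0)// mulr_ge0 ?subr_ge0//.
  by rewrite -natrX ler_nat.
by move: (M%:R ^+ d) (n%:R ^+ d) (N%:R ^+ d) => m1 n1 N1; lra.
Qed.

End tilings.

(** * Comparison of the pressures *)

Section local_ball_covers.
Variables (R : realType) (d : nat) (X : metricType R).
Variables (T : 'rV[R]_d -> X -> X) (eps delta : R).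

Lemma coverable_setU D psi (E E' : set X) c c' :
  coverable T eps D psi E c -> coverable T eps D psi E' c' ->
  coverable T eps D psi (E `|` E') (c + c').
Proof.
move=> [r [s [re sP sE sc]]] [r' [s' [re' sP' sE' sc']]].
exists (Num.max r r'), (s ++ s'); split.
- by rewrite gt_max re re'.
- move=> p; rewrite mem_cat => /orP[/sP|/sP'] [po pr pw]; split=> // x y u px py Du.
    by rewrite le_max pr.
  by rewrite le_max pr ?orbT.
- move=> x [/sE|/sE'] [p ps px]; exists p => //; rewrite mem_cat ps ?orbT//.
- by rewrite big_cat/= lerD.
Qed.

Lemma coverable_empty D psi c : 0 <= c -> coverable T eps D psi set0 c.
Proof. by move=> c0; exists (eps - 1), [::]; split=> //; [lra|rewrite big_nil]. Qed.

(** A nonempty member of the first cover lies in the Bowen ball of radius [delta] about any of its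
    points. Its weight is nonnegative, so it contributes at least 1 to [c], which pays for one cover
    of cost [c']. *)
Lemma coverable_local_balls D psi c c' : [set: X] !=set0 ->
  coverable T delta D (fun=> 0) [set: X] c ->
  (forall x, coverable T eps D psi (local_ball T delta D x) c') ->
  coverable T eps D psi [set: X] (c * c').
Proof.
move=> [x0 _] [r [s [rd sP sE sc]]] xc.
have c'0 : 0 <= c' := coverable_ge0 (xc x0).
suff : coverable T eps D psi (\bigcup_(p in [set` s]) p.1)
    ((\sum_(p <- s) expR p.2) * c').
  apply: coverableS => //.
  exact: ler_wpM2r.
elim: s sP {sE sc} => [|p s IHs] sP.
  by rewrite bigcup0 ?big_nil ?mul0r//; exact: coverable_empty.
have -> : \bigcup_(q in [set` p :: s]) q.1 =
    p.1 `|` \bigcup_(q in [set` s]) q.1.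
  apply/seteqP; split=> [y [q /=]|y [py|[q /= qs qy]]].
  - by rewrite inE => /predU1P[->|qs] qy; [left|right; exists q].
  - by exists p => //=; rewrite mem_head.
  - by exists q => //=; rewrite inE qs orbT.
rewrite big_cons mulrDl; apply: coverable_setU; last first.
  by apply: IHs => q qs; apply: sP; rewrite inE qs orbT.
have [_ pr p0] := sP p (mem_head _ _).
have [[x px]|pE] := pselect (p.1 !=set0); last first.
  have -> : p.1 = set0 by apply/seteqP; split=> // y py; apply: pE; exists y.
  by apply: coverable_empty; rewrite mulr_ge0// expR_ge0.
apply: coverableS (xc x) => // [y py u Du|].
  by rewrite (le_trans (pr _ _ _ px py Du))// ltW.
by rewrite ler_peMl// -expR0 ler_expR; exact: p0 px.
Qed.

End local_ball_covers.

(** * The infimal growth rate of covers of Bowen balls *)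

Section pressure_bound.
Variables (R : realType) (d : nat) (X : metricType R).
Variables (T : 'rV[R]_d -> X -> X) (phi : X -> R) (H eps delta : R).
Hypothesis X_nonempty : [set: X] !=set0.
Hypothesis X_compact : compact [set: X].
Hypothesis T_action : continuous_action T.
Hypothesis phi_continuous : continuous phi.
Hypothesis phi_le : forall x, `|phi x| <= H.
Hypotheses (eps_gt0 : 0 < eps) (eps_lt1 : eps < 1) (delta_gt0 : 0 < delta).

Let kappa := ln (1 / eps).
Notation coverable_on := (orbit_coverable T phi eps kappa).

Let kappa_gt0 : 0 < kappa. Proof. exact: ln_inv_gt0. Qed.

Let H_ge0 : 0 <= H.
Proof. by have [x _] := X_nonempty; exact: le_trans (normr_ge0 _) (phi_le x). Qed.

(** The infimum of this set is the number b of the overview; rates here are natural logarithms. *)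
Definition growth_rates : set R := [set s | exists2 M : nat, (0 < M)%N &
  forall x, coverable_on (cube M%:R) (local_ball T delta (cube M%:R) x)
    (expR (s * M%:R ^+ d))].

Lemma has_inf_growth_rates : has_inf growth_rates.
Proof.
split; last first.
  (* Any cover of a Bowen ball has a member containing the centre [x], whose weight is at least
     [- kappa * H * M ^ d]. *)
  exists (- (kappa * H)) => s [M M0 cM]; have [x _] := X_nonempty.
  have Md : 0 < M%:R ^+ d :> R by rewrite exprn_gt0// ltr0n.
  have xx : local_ball T delta (cube M%:R) x x by move=> u _; rewrite mdistxx ltW.
  have := coverable_ge (cM x) xx; rewrite ler_expR.
  have M0' : 0 <= M%:R :> R by [].
  have := orbit_integral_norm_le T_action phi_continuous phi_le x
    (@finite_volume_cube R d _ M0').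
  rewrite volume_cube// ler_norml => /andP[/(ler_wpM2l (ltW kappa_gt0)) h _] h'.
  rewrite -(ler_pM2r Md); apply: le_trans h'; apply: le_trans h.
  by rewrite mulrN mulrA mulNr.
have [c cP] := @coverable_cube R d X T X_compact T_action 1 eps eps_gt0.
(* [c <= expR c] turns the cost of a cover over the unit cube into a rate. *)
exists (c + kappa * H), 1%N => // x; rewrite expr1n mulr1 expRD.
have := coverableD (kappa * H) cP; apply: coverableS => //.
- move=> y; rewrite add0r ler_wpM2l ?(ltW kappa_gt0)//.
  have := orbit_integral_norm_le T_action phi_continuous phi_le y
    (@finite_volume_cube R d 1 ler01).
  by rewrite volume_cube// expr1n mulr1; apply: le_trans; exact: ler_norm.
- by rewrite ler_wpM2r ?expR_ge0// (le_trans _ (expR_ge1Dx c))// lerDr.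
Qed.

(** If [q * ln 2 < b], then [local_ball_improve] turns a rate close enough to [b] into one below
    [b]. *)
Lemma inf_growth_rates_le (q : R) :
  (forall x, pressure T phi (orbit_ball T delta x) eps < q%:E)%E ->
  inf growth_rates <= q * ln 2.
Proof.
move=> qP; rewrite leNgt; apply/negP; set b := inf growth_rates => qb.
have [hne hlb] := has_inf_growth_rates.
(* The midpoint leaves room on both sides: below it for rounding the tiles to multiples of [M],
   above it for the improvement. *)
pose q' := (q * ln 2 + b) / 2.
have qq' : q * ln 2 < q' by rewrite /q'; lra.
have q'b : q' < b by rewrite /q'; lra.
have p4 : 0 < 4 ^+ d :> R by rewrite exprn_gt0.
have gap0 : 0 < (b - q') / 4 ^+ d by rewrite divr_gt0// subr_gt0.
(* [b''] exceeds [b] by less than the improvement will gain. Its side [M] is fixed before the tile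
   sizes, which are then counted in units of [M]. *)
have [b'' [M M0 cM] b''b] := inf_adherent gap0 has_inf_growth_rates.
have bb'' : b <= b'' by apply: ge_inf => //; exists M.
have [L0 L0P] := orbit_coverable_round_down eps T_action phi_continuous phi_le
  H_ge0 (ltW kappa_gt0) M0 qq'.
have ballP x : exists2 l, (0 < l)%N & coverable_on (cube (M%:R * l%:R))
    (orbit_ball T delta x) (expR (q' * (M%:R * l%:R) ^+ d)).
  have [L [L_gt0 L0L] cL] := cover_cost_lt_of_pressure (qP x) L0.
  apply: L0P L0L _; exact: coverable_of_cover_cost cL.
have [N NP] := coverable_local_ball X_compact T_action ballP.
have [x0 _] := X_nonempty.
have N0 : (0 < N)%N by have [l /andP[l0 lN] _] := NP x0; exact: leq_trans lN.
have q'b'' : q' <= b'' by rewrite (le_trans (ltW q'b)).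
have cMN := local_ball_improve T_action phi_continuous phi_le eps_gt0
  M0 q'b'' NP cM.
have : growth_rates (b'' - (b'' - q') / 4 ^+ d).
  by exists (M * (4 * N))%N; rewrite ?muln_gt0 ?M0// natrM.
move=> /(ge_inf hlb); rewrite -/b.
have : (b - q') / 4 ^+ d <= (b'' - q') / 4 ^+ d.
  by rewrite ler_pM2r ?invr_gt0// lerD2r.
by move: b''b; rewrite -/b; lra.
Qed.

(** Over [cube V], unit cubes give a cover at scale [delta] of cost at most [c ^ (V ^ d)], and
    [local_ball_grid] covers each Bowen ball at cost [expR (s * V ^ d)]. *)
Lemma pressure_le_growth_rate (s c : R) : growth_rates s ->
  coverable T delta (@cube R d 1) (fun=> 0) [set: X] c ->
  (pressure T phi [set: X] eps <= ((s + ln c) / ln 2)%:E)%E.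
Proof.
move=> [M M0 cM] cc; apply: pressure_le_of_cover_cost => // L0.
have [x0 _] := X_nonempty.
have c0 : 0 < c.
  by apply: lt_le_trans (coverable_ge cc (I : [set: X] x0)); rewrite expR_gt0.
(* [V] is a multiple of [M], as the grid of side [M] requires, and an integer, as the unit grid
   requires. *)
pose n := (Num.truncn `|L0|).+1; pose V : R := (M * n)%N%:R.
have nL0 : L0 < n%:R by rewrite (le_lt_trans (ler_norm L0))// truncnS_gt.
have V0 : 0 < V by rewrite ltr0n muln_gt0 M0.
have L0V : L0 < V.
  by rewrite (lt_le_trans nL0)// ler_nat leq_pmull.
exists V => //; apply: cover_cost_of_coverable => //.
have M0' : 0 < M%:R :> R by rewrite ltr0n.
have grid := local_ball_grid T_action phi_continuous phi_le eps_gt0 n M0' cM.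
have cV : coverable T delta (cube V) (fun=> 0) [set: X] (c ^+ ((M * n) ^ d)).
  have : orbit_coverable T phi delta 0 (cube (1 * (M * n)%N%:R)) setT
      (c ^+ ((M * n) ^ d)).
    apply: (coverable_grid T_action phi_continuous phi_le) => // t.
    by exists setT => //; apply: coverableS cc => // y; rewrite mul0r.
  by rewrite mul1r; apply: coverableS => // y; rewrite mul0r.
have := coverable_local_balls X_nonempty cV.
rewrite /V natrM => /(_ _ _ _ grid); apply: coverableS => //.
rewrite -expRM_natl -[X in X ^+ _ * _]lnK ?posrE// -expRM_natl -expRD ler_expR.
rewrite !natrX natrM exprMn.
have -> : (s + ln c) / ln 2 * ln 2 = s + ln c.
  by rewrite divfK// gt_eqF// ln2_gt0.
by lra.
Qed.

Lemma pressure_le_local (c : R) :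
  coverable T delta (@cube R d 1) (fun=> 0) [set: X] c ->
  (pressure T phi [set: X] eps <=
   ereal_sup [set pressure T phi (orbit_ball T delta x) eps | x in [set: X]] +
   (ln c / ln 2)%:E)%E.
Proof.
move=> cc; apply: lee_addC_of_gt => q Sq.
have /inf_growth_rates_le bq x : (pressure T phi (orbit_ball T delta x) eps < q%:E)%E.
  by apply: le_lt_trans Sq; apply: ereal_sup_ubound; exists x.
apply/lee_addgt0Pr => e e0.
have e2 : 0 < e * ln 2 by rewrite mulr_gt0// ln2_gt0.
have [s sP sb] := inf_adherent e2 has_inf_growth_rates.
apply: (le_trans (pressure_le_growth_rate sP cc)).
rewrite -EFinD lee_fin ler_pdivrMr ?ln2_gt0// !mulrDl divfK ?gt_eqF ?ln2_gt0//.
by move: sb bq; lra.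
Qed.

End pressure_bound.

Theorem theorem7p1 (R : realType) (d : nat) (X : metricType R)
    (T : 'rV[R]_d -> X -> X) (phi : X -> R) (delta : R)
    (hd : (1 <= d)%N)
    (X_nonempty : [set: X] !=set0)
    (X_compact : compact [set: X])
    (T_action : continuous_action T)
    (phi_continuous : continuous phi)
    (delta_gt0 : 0 < delta) :
  upper_mdim T phi =
    limf_esup (fun eps : R =>
      (ereal_sup [set pressure T phi (orbit_ball T delta x) eps | x in [set: X]]
        * ((log2 (1 / eps))^-1)%:E)%E) 0^'+ /\
  lower_mdim T phi =
    limf_einf (fun eps : R =>
      (ereal_sup [set pressure T phi (orbit_ball T delta x) eps | x in [set: X]]
        * ((log2 (1 / eps))^-1)%:E)%E) 0^'+.
Proof.
have [H phi_le] := compact_fun_bounded X_compact phi_continuous.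
(* [c] is fixed before [eps], so [ln c] is negligible against [ln (1 / eps)]. *)
have [c cc] := @coverable_cube R d X T X_compact T_action 1 delta delta_gt0.
have log_gt0 (eps : R) : 0 < eps -> eps < 1 -> 0 < (log2 (1 / eps))^-1.
  by move=> e0 e1; rewrite invr_gt0 divr_gt0 ?ln_inv_gt0 ?ln2_gt0.
pose f eps : \bar R := (pressure T phi [set: X] eps * ((log2 (1 / eps))^-1)%:E)%E.
pose g eps : \bar R :=
  (ereal_sup [set pressure T phi (orbit_ball T delta x) eps | x in [set: X]]
    * ((log2 (1 / eps))^-1)%:E)%E.
have fg (e : R) : 0 < e -> \forall eps \near 0^'+, (f eps <= g eps + e%:E)%E.
  move=> e0; near=> eps.
  have eps0 : 0 < eps by [].
  have eps1 : eps < 1 by near: eps; exact: nbhs_right_lt.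
  (* This says [ln c / ln (1 / eps) < e], so the additive constant stays within the slack. *)
  have epsc : eps < expR (- (ln c / e)).
    by near: eps; apply: nbhs_right_lt; exact: expR_gt0.
  have w0 := log_gt0 eps eps0 eps1.
  have := pressure_le_local X_nonempty X_compact T_action phi_continuous phi_le
    eps0 eps1 delta_gt0 cc.
  move=> /(lee_wpmul2r (ltW w0 : (0 <= _%:E)%E)) /le_trans; apply.
  rewrite muleDl; [|by []|exact: fin_num_adde_defl].
  apply: leeD => //; rewrite -EFinM lee_fin.
  have l0 := ln_inv_gt0 eps0 eps1.
  rewrite /log2 invf_div mulrA divfK ?gt_eqF ?ln2_gt0// ler_pdivrMr//.
  rewrite mulrC -ler_pdivrMr// div1r lnV ?posrE//.
  by rewrite lerNr -(ler_expR) lnK ?posrE// ltW.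
(* The converse is monotonicity of [pressure] in the set. *)
have gf (e : R) : 0 < e -> \forall eps \near 0^'+, (g eps <= f eps + e%:E)%E.
  move=> e0; near=> eps.
  have eps0 : 0 < eps by [].
  have eps1 : eps < 1 by near: eps; exact: nbhs_right_lt.
  have w0 := log_gt0 eps eps0 eps1.
  apply: (@le_trans _ _ (f eps)); last by rewrite leeDl// lee_fin ltW.
  apply: lee_wpmul2r; first by rewrite lee_fin ltW.
  by apply: ge_ereal_sup => _ [x _ <-]; exact: le_pressure.
split; apply/eqP; rewrite eq_le; apply/andP; split.
- exact: limf_esup_le fg.
- exact: limf_esup_le gf.
- exact: limf_einf_le fg.
- exact: limf_einf_le gf.
Unshelve. all: by end_near. Qed.
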